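(* Let $P$ be a simple polytope, let $\lambda$ be an $\mathcal{R}$-characteristic function on $P$, and let $M(P,\lambda)$ be the associated toric orbifold. Then there exists a resolution of singularities $$M(P^{(d)},\lambda^{(d)})\to \dots \to M(P^{(1)},\lambda^{(1)})\to M(P^{(0)},\lambda^{(0)})=M(P,\lambda),$$ that is, there are an integer $d\ge 0$ and $\mathcal{R}$-characteristic pairs $(P^{(i)},\lambda^{(i)})$, $i=0,1,\dots,d$, with $(P^{(0)},\lambda^{(0)})=(P,\lambda)$, such that $M(P^{(d)},\lambda^{(d)})$ is a toric manifold and, for each $i=1,2,\dots,d$, the toric orbifold $M(P^{(i)},\lambda^{(i)})$ is a blowup of $M(P^{(i-1)},\lambda^{(i-1)})$ (the arrows indicate the associated blowups).
   Context: A convex polytope of dimension $n$ is simple if each of its vertices is the intersection of exactly $n$ facets (codimension-one faces). $V(P)$ denotes the vertex set and $\mathcal{F}(P)=\{F_1,\dots,F_r\}$ the facet set of $P$. $\mathcal{R}$-characteristic pairs. Let $P$ be an $n$-dimensional simple polytope. A function $\lambda\colon\mathcal{F}(P)\to\mathbb{Z}^n$ is an $\mathcal{R}$-characteristic function if each $\lambda(F_i)$ is primitive and $\{\lambda(F_{i_1}),\dots,\lambda(F_{i_k})\}$ is linearly independent whenever $F_{i_1},\dots,F_{i_k}$ are distinct facets with $\bigcap_{j=1}^kF_{i_j}\neq\varnothing$; $(P,\lambda)$ is then an $\mathcal{R}$-characteristic pair. If moreover each such set spans a $k$-dimensional unimodular submodule (a rank-$k$ direct summand) of $\mathbb{Z}^n$,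 then $\lambda$ is called a characteristic function and $(P,\lambda)$ a characteristic pair. Toric orbifolds and toric manifolds. Let $T^n$ be the standard $n$-torus, with exponential map $\exp\colon\mathbb{R}^n=\mathbb{Z}^n\otimes_{\mathbb{Z}}\mathbb{R}\to T^n$. Given an $\mathcal{R}$-characteristic pair $(P,\lambda)$, let $T_i\subset T^n$ be the circle subgroup that is the image under $\exp$ of the line spanned by $\lambda(F_i)$. For a codimension-$k$ face $F=\bigcap_{j=1}^kF_{i_j}$, $0<k\le n$, let $T_F=\langle T_{i_1},\dots,T_{i_k}\rangle$, and let $T_P=1$. The toric orbifold is $M(P,\lambda)=(T^n\times P)/\sim$, where $(t,x)\sim(s,y)$ if and only if $x=y$ lies in the relative interior $\mathring{F}$ of a face $F$ and $t^{-1}s\in T_F$. It is a $2n$-dimensional orbifold with $T^n$-action induced by multiplication on the first factor and orbit map $\pi\colon M(P,\lambda)\to P$, $[t,x]\mapsto x$. When $\lambda$ is a characteristic function, $M(P,\lambda)$ is called a toric manifold. Blowup of a polytope. Let $P\subset\mathbb{R}^n$ be an $n$-dimensional simple polytope and $F$ a face of $P$. Take a hyperplane $H$ in $\mathbb{R}^n$ such that $V(F)\subset H_{>0}$ and $V(P)\setminus V(F)\subset H_{<0}$, where $H_{>0},H_{<0}$ are the two open half-spaces bounded by $H$. Then $\overline{P}:=P\cap H_{\le 0}$ is called a blowup of $P$ along $F$; it is again an $n$-dimensional simple polytope. If $\dim F<n-1$, its facets are $\overline{F}_i=F_i\cap\overline{P}$ for $i=1,\dots,r$ and $\overline{F}_{r+1}=H\cap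 P$. Blowup of a toric orbifold. Let $\overline{P}$ be a blowup of $P$ along a face $F$, and let $(P,\lambda)$ and $(\overline{P},\overline{\lambda})$ be $\mathcal{R}$-characteristic pairs such that $\overline{\lambda}(\overline{F}_i)=\lambda(F_i)$ whenever $\overline{F}_i=F_i\cap\overline{P}$ for $F_i\in\mathcal{F}(P)$. Then $M(\overline{P},\overline{\lambda})$ is called a blowup of $M(P,\lambda)$ along the suborbifold $\pi^{-1}(F)$. *)

(* Defs.v *)
(* [R : realType] plays the role of the field of real numbers. *)
From HB Require Import structures.
From mathcomp Require Import all_boot all_order all_algebra.
From mathcomp Require Import all_classical all_reals all_analysis.
From mathcomp Require Import ring.
Import Order.TTheory GRing.Theory Num.Theory.
Import numFieldNormedType.Exports.

Set Implicit Arguments.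
Unset Strict Implicit.
Unset Printing Implicit Defensive.

Local Open Scope classical_set_scope.
Local Open Scope card_scope.
Local Open Scope ring_scope.
Local Open Scope quotient_scope.

Section Polytopes.
Context (R : realType) (n : nat).
Implicit Types (P F G : set 'rV[R]_n) (a x v : 'rV[R]_n).

Definition dot a x : R := \sum_(j < n) a 0 j * x 0 j.

Definition polytope P : Prop :=
  bounded_set P /\
  exists (m : nat) (a : 'I_m -> 'rV[R]_n) (b : 'I_m -> R),
    P = [set x | forall i, dot (a i) x <= b i].

(* [x0] and the points [x0 + row i B] form an affine basis of the affine hull
   of [F]; in particular the empty set has no dimension. *)
Definition has_dim F (k : nat) : Prop :=
  exists (x0 : 'rV[R]_n) (B : 'M[R]_(k, n)),
    [/\ F x0, forall i, F (x0 + row i B), row_free B &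
        forall x, F x -> (x - x0 <= B)%MS].

(* Nonempty faces; [P] is a face of itself (take [a = 0] and [c = 0]). *)
Definition face P F : Prop :=
  F !=set0 /\
  exists (a : 'rV[R]_n) (c : R),
    (forall x, P x -> dot a x <= c) /\ F = P `&` [set x | dot a x = c].

Definition facet P F : Prop :=
  face P F /\ exists k, has_dim F k /\ has_dim P k.+1.

Definition vertices P : set 'rV[R]_n := [set v | face P [set v]].

Definition facets_at P v : set (set 'rV[R]_n) := [set F | facet P F /\ F v].

(* The intersection with [P] only matters for the empty intersection ([n = 0]). *)
Definition simple_polytope P : Prop :=
  [/\ polytope P, has_dim P n &
      forall v, vertices P v ->
        facets_at P v #= `I_n /\ P `&` \bigcap_(F in facets_at P v) F = [set v]].

Definition affine_hull F : set 'rV[R]_n :=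
  [set y | exists (k : nat) (p : 'I_k -> 'rV[R]_n) (c : 'I_k -> R),
     [/\ forall i, F (p i), \sum_i c i = 1 & y = \sum_i c i *: p i]].

Definition relint F : set 'rV[R]_n :=
  [set x | F x /\ \forall y \near x, affine_hull F y -> F y].

Definition polytope_blowup P F (P' : set 'rV[R]_n) : Prop :=
  exists (a : 'rV[R]_n) (c : R),
    [/\ a != 0,
        forall v, vertices F v -> dot a v > c,
        forall v, vertices P v -> ~ vertices F v -> dot a v < c &
        P' = P `&` [set x | dot a x <= c]].

End Polytopes.

Section Lattice.
Context (n : nat).

Definition primitive (u : 'rV[int]_n) : Prop :=
  forall (d : int) (w : 'rV[int]_n), u = d *: w -> `|d| = 1.

Definition lin_indep k (A : 'M[int]_(k, n)) : Prop :=
  forall c : 'rV[int]_k, c *m A = 0 -> c = 0.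

Definition zspan k (A : 'M[int]_(k, n)) : set 'rV[int]_n :=
  [set c *m A | c in [set: 'rV[int]_k]].

Definition submodule (L : set 'rV[int]_n) : Prop :=
  L 0 /\ forall u w, L u -> L w -> L (u - w).

Definition direct_summand (L : set 'rV[int]_n) : Prop :=
  exists N : set 'rV[int]_n,
    [/\ submodule N, L `&` N = [set 0] &
        forall u, exists v w, [/\ L v, N w & u = v + w]].

End Lattice.

Section Characteristic.
Context (R : realType) (n : nat).
Implicit Types (P : set 'rV[R]_n) (lam : set 'rV[R]_n -> 'rV[int]_n).

(* [lam] is only meaningful on the facets of [P]. *)
Definition Rcharacteristic P lam : Prop :=
  (forall F, facet P F -> primitive (lam F)) /\
  forall (k : nat) (F : 'I_k -> set 'rV[R]_n),
    injective F -> (forall i, facet P (F i)) ->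
    \bigcap_i F i !=set0 ->
    lin_indep (\matrix_(i < k) lam (F i)).

Definition characteristic P lam : Prop :=
  Rcharacteristic P lam /\
  forall (k : nat) (F : 'I_k -> set 'rV[R]_n),
    injective F -> (forall i, facet P (F i)) ->
    \bigcap_i F i !=set0 ->
    direct_summand (zspan (\matrix_(i < k) lam (F i))).

End Characteristic.

Record Rcharacteristic_pair (R : realType) (n : nat) := RCharacteristicPair {
  rpoly : set 'rV[R]_n;
  rlam : set 'rV[R]_n -> 'rV[int]_n;
  rpoly_simple : simple_polytope rpoly;
  rlam_char : Rcharacteristic rpoly rlam
}.

(* The torus [T^n] inside [C^n = R^n + i R^n], a point being the pair of its
   real and imaginary parts. *)
Section Torus.
Context (R : realType) (n : nat).
Local Notation Cn := ('rV[R]_n * 'rV[R]_n)%type.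
Implicit Types z w : Cn.

Definition torus : set Cn :=
  [set z : Cn | forall j, z.1 0 j ^+ 2 + z.2 0 j ^+ 2 = 1].

Definition tone : Cn := (const_mx 1, 0).
Definition tinv z : Cn := (z.1, - z.2).
Definition tmul z w : Cn :=
  (\row_j (z.1 0 j * w.1 0 j - z.2 0 j * w.2 0 j),
   \row_j (z.1 0 j * w.2 0 j + z.2 0 j * w.1 0 j)).

Definition texp (v : 'rV[R]_n) : Cn :=
  (\row_j cos (2 * pi * v 0 j), \row_j sin (2 * pi * v 0 j)).

Definition circle_subgroup (u : 'rV[int]_n) : set Cn :=
  [set texp (c *: map_mx intr u) | c in [set: R]].

Definition tsubgroup (H : set Cn) : Prop :=
  [/\ H `<=` torus, H tone & forall z w, H z -> H w -> H (tmul (tinv z) w)].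

Definition tgenerated (A : set Cn) : set Cn :=
  [set z | forall H, tsubgroup H -> A `<=` H -> H z].

Lemma tmulA z1 z2 z3 : tmul z1 (tmul z2 z3) = tmul (tmul z1 z2) z3.
Proof. by congr pair; apply/rowP => j; rewrite !mxE; ring. Qed.

Lemma tmul1 z : tmul tone z = z.
Proof.
by case: z => z1 z2; congr pair; apply/rowP => j; rewrite !mxE /=; ring.
Qed.

Lemma tinvK z : tinv (tinv z) = z.
Proof. by case: z => z1 z2; rewrite /tinv /= opprK. Qed.

Lemma tinvM z w : tinv (tmul z w) = tmul (tinv w) (tinv z).
Proof. by congr pair; apply/rowP => j; rewrite !mxE /=; ring. Qed.

Lemma tmulVt z : torus z -> tmul (tinv z) z = tone.
Proof.
move=> Tz; congr pair; apply/rowP => j; rewrite !mxE /=; last by ring.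
by rewrite -(Tz j); ring.
Qed.

Lemma tmul1r z : tmul z tone = z.
Proof.
by case: z => z1 z2; congr pair; apply/rowP => j; rewrite !mxE /=; ring.
Qed.

Lemma tgenerated1 A : tgenerated A tone.
Proof. by move=> H []. Qed.

Lemma tgenerated_div A z w :
  tgenerated A z -> tgenerated A w -> tgenerated A (tmul (tinv z) w).
Proof. by move=> Az Aw H sH AH; have [_ _] := sH; apply; [exact: Az|exact: Aw]. Qed.

Lemma tgeneratedV A z : tgenerated A z -> tgenerated A (tinv z).
Proof.
by move=> Az; rewrite -[tinv z]tmul1r; apply: tgenerated_div => //; exact: tgenerated1.
Qed.

Lemma tgeneratedM A z w :
  tgenerated A z -> tgenerated A w -> tgenerated A (tmul z w).
Proof.
by move=> Az Aw; rewrite -[z]tinvK; apply: tgenerated_div => //; exact: tgeneratedV.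
Qed.

End Torus.

Section RelativeInteriors.
Context (R : realType) (n : nat).
Implicit Types (P F G : set 'rV[R]_n) (x : 'rV[R]_n).

Lemma dotD (a x y : 'rV[R]_n) : dot a (x + y) = dot a x + dot a y.
Proof. by rewrite /dot -big_split; apply: eq_bigr => j _; rewrite mxE mulrDr. Qed.

Lemma dotZ (a x : 'rV[R]_n) (c : R) : dot a (c *: x) = c * dot a x.
Proof. by rewrite /dot mulr_sumr; apply: eq_bigr => j _; rewrite mxE mulrCA. Qed.

Lemma dot_sum (a : 'rV[R]_n) k (p : 'I_k -> 'rV[R]_n) :
  dot a (\sum_i p i) = \sum_i dot a (p i).
Proof.
rewrite /dot exchange_big; apply: eq_bigr => j _.
by rewrite summxE mulr_sumr.
Qed.

Lemma dot_suml k (a : 'I_k -> 'rV[R]_n) (I : pred 'I_k) (x : 'rV[R]_n) :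
  dot (\sum_(i | I i) a i) x = \sum_(i | I i) dot (a i) x.
Proof.
rewrite /dot exchange_big; apply: eq_bigr => j _.
by rewrite summxE mulr_suml.
Qed.

Lemma dot_continuous (a : 'rV[R]_n) : continuous (dot a).
Proof.
apply: continuous_big => [|j _ x]; first exact: add_continuous.
by apply: continuousM; [exact: cst_continuous|exact: coord_continuous].
Qed.

Lemma face_sub P F : face P F -> F `<=` P.
Proof. by move=> [_ [a [c [_ ->]]]] x []. Qed.

Lemma relint_sub_face P F G x :
  face P F -> face P G -> relint F x -> G x -> F `<=` G.
Proof.
move=> fF [_ [a [c [Pac GE]]]] [Fx nearF] Gx y Fy.
have ax : dot a x = c by move: Gx; rewrite GE => -[].
have cv : (x + e *: (x - y)) @[e --> (0 : R)] --> x.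
  rewrite -[X in _ --> X](_ : x + (0 : R) *: (x - y) = x); last first.
    by rewrite scale0r addr0.
  apply: cvgD; first exact: cvg_cst.
  by apply: cvgZr_tmp; exact: cvg_id.
have [e /= e0 eP] : exists2 e : R, 0 < e &
    (affine_hull F (x + e *: (x - y)) -> F (x + e *: (x - y))).
  have /nbhs_ballP[d /= d0 dP] := cv _ nearF.
  exists (d / 2); first by rewrite divr_gt0.
  apply: dP; rewrite /ball /= sub0r normrN gtr0_norm ?divr_gt0//.
  by rewrite ltr_pdivrMr// ltr_pMr// ltr1n.
have /eP Fz : affine_hull F (x + e *: (x - y)).
  exists 2, (fun i => if i == 0 :> 'I_2 then x else y),
    (fun i => if i == 0 :> 'I_2 then 1 + e else - e).
  rewrite !big_ord_recl !big_ord0 /=; split.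
  - by move=> i; case: ifP.
  - by rewrite addr0 addrK.
  - by rewrite addr0 scalerDl scale1r scalerBr scaleNr addrA.
have := Pac _ (face_sub fF Fz); rewrite dotD dotZ dotD -scaleN1r dotZ ax.
rewrite mulN1r -subr_ge0 => h; rewrite GE; split; first exact: face_sub fF _ Fy.
apply/eqP; rewrite eq_le Pac/=; last exact: face_sub fF _ Fy.
rewrite -subr_ge0 -(pmulr_rge0 _ e0) -oppr_le0.
move: h; rewrite opprD addrA subrr add0r oppr_ge0; rewrite -mulrN opprB //.
Qed.

Lemma relint_face_uniq P F G x :
  face P F -> face P G -> relint F x -> relint G x -> F = G.
Proof.
move=> fF fG rF rG; apply/seteqP; split.
  by apply: (relint_sub_face fF fG rF); case: rG.
by apply: (relint_sub_face fG fF rG); case: rF.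
Qed.

Lemma relint_face_exists P x :
  polytope P -> P x -> exists2 F, face P F & relint F x.
Proof.
move=> [_ [m [a [b PE]]]] Px.
pose I := [pred i | dot (a i) x == b i].
pose A := \sum_(i | I i) a i; pose B := \sum_(i | I i) b i.
have PAB y : P y -> dot A y <= B.
  by rewrite PE => Py; rewrite dot_suml; apply: ler_sum => i _; exact: Py.
have AxB : dot A x = B by rewrite dot_suml; apply: eq_bigr => i /eqP.
have FI y : P y -> dot A y = B -> forall i, I i -> dot (a i) y = b i.
  rewrite PE => Py AyB i Ii; apply/eqP/negPn/negP => ne.
  have : dot A y < B.
    rewrite dot_suml /B (bigD1 i)//= [ltRHS](bigD1 i)//=.
    apply: ltr_leD; first by rewrite lt_neqAle ne Py.
    by apply: ler_sum => k _; exact: Py.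
  by rewrite AyB ltxx.
exists (P `&` [set y | dot A y = B]).
  by split; [exists x | exists A, B].
split => //=.
have : \forall y \near x, forall i, ~~ I i -> dot (a i) y < b i.
  apply: (@filter_forall _ _ (fun i y => ~~ I i -> dot (a i) y < b i) (nbhs x)).
  move=> i.
  case: (boolP (I i)) => [Ii|nIi]; first by apply: nearW => y.
  have lt : dot (a i) x < b i.
    by rewrite lt_neqAle nIi /=; move: Px; rewrite PE; exact.
  have near_lt : \forall y \near x, dot (a i) y < b i.
    exact: (@dot_continuous (a i) x _ (lt_nbhsl lt)).
  by move: near_lt; apply: filterS => y /= + _.
apply: filterS => y yP [k [p [c [Fp c1 yE]]]]; rewrite yE in yP *.
have eqI i : I i -> dot (a i) (\sum_j c j *: p j) = b i.
  move=> Ii; rewrite dot_sum -[RHS]mul1r -c1 mulr_suml.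
  by apply: eq_bigr => j _; rewrite dotZ (FI (p j))//; case: (Fp j).
split; last by rewrite /= dot_suml; apply: eq_bigr => i; exact: eqI.
rewrite PE => i; case: (boolP (I i)) => [/eqI ->//|/yP/ltW]; exact.
Qed.

End RelativeInteriors.

Section ToricOrbifold.
Context (R : realType) (n : nat) (X : Rcharacteristic_pair R n).
Local Notation P := (rpoly X).

(* [T_F], generated by the circles of the facets containing [F]; for [F = P]
   there are none. *)
Definition face_subgroup (F : set 'rV[R]_n) : set ('rV[R]_n * 'rV[R]_n) :=
  tgenerated
    (\bigcup_(G in [set G | facet P G /\ F `<=` G]) circle_subgroup (rlam X G)).

Definition torus_polytope : topologicalType :=
  (set_type (@torus R n) * set_type P)%type.

Definition toric_rel (p q : torus_polytope) : bool :=
  `[< p.2 = q.2 /\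
      exists F, [/\ face P F, relint F (\val p.2) &
                    face_subgroup F (tmul (tinv (\val p.1)) (\val q.1))] >].

Lemma toric_rel_equiv : equiv_class_of toric_rel.
Proof.
have dv (t : set_type (@torus R n)) : tmul (tinv (\val t)) (\val t) = tone R n.
  exact: tmulVt (set_mem (valP t)).
split.
- move=> p; apply/asboolP; split => //.
  have [||F fF rF] := @relint_face_exists R n P (\val p.2).
  + by case: (rpoly_simple X).
  + by move: (set_mem (valP p.2)).
  + by exists F; split => //; rewrite dv; exact: tgenerated1.
- suff sym p q : toric_rel p q -> toric_rel q p.
    by move=> p q; apply/idP/idP; exact: sym.
  move=> /asboolP[e [F [fF rF tF]]]; apply/asboolP; split; first by [].
  exists F; split => //; first by rewrite -e.
  by have := tgeneratedV tF; rewrite tinvM tinvK.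
- move=> q p r /asboolP[e1 [F [fF rF tF]]] /asboolP[e2 [G [fG rG tG]]].
  apply/asboolP; split; first by rewrite e1.
  exists F; split => //.
  have FG : F = G by apply: (relint_face_uniq fF fG rF); rewrite e1.
  have := tgeneratedM tF; rewrite {}FG => /(_ _ tG).
  have qV : tmul (\val q.1) (tinv (\val q.1)) = tone R n.
    rewrite -[X in tmul X _]tinvK tmulVt// => j /=.
    by rewrite mxE sqrrN; move: (set_mem (valP q.1)); exact.
  by rewrite -tmulA [tmul (\val q.1) _]tmulA qV tmul1.
Qed.

Canonical toric_equiv := EquivRelPack toric_rel_equiv.

Definition toric_orbifold : topologicalType :=
  quotient_topology {eq_quot toric_equiv}.

Definition orbit_map (m : toric_orbifold) : set_type P :=
  (repr (m : {eq_quot toric_equiv})).2.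

Lemma orbit_mapE (p : torus_polytope) :
  orbit_map (\pi_({eq_quot toric_equiv}) p) = p.2.
Proof.
rewrite /orbit_map.
by case: piP => q /eqmodP /asboolP[].
Qed.

End ToricOrbifold.

Definition toric_manifold (R : realType) (n : nat) (X : Rcharacteristic_pair R n)
  : Prop := characteristic (rpoly X) (rlam X).

(* [toric_blowup Y X S]: the orbifold of [Y] is a blowup of that of [X] along
   the subset [S]. *)
Definition toric_blowup (R : realType) (n : nat) (Y X : Rcharacteristic_pair R n)
    (S : set (toric_orbifold X)) : Prop :=
  exists F : set 'rV[R]_n,
    [/\ face (rpoly X) F,
        S = [set m | F (\val (orbit_map m))],
        polytope_blowup (rpoly X) F (rpoly Y) &
        forall G, facet (rpoly X) G -> facet (rpoly Y) (G `&` rpoly Y) ->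
          rlam Y (G `&` rpoly Y) = rlam X G].

Arguments toric_blowup {R n} Y X S.

(* Main.v *)
(* A simple polytope is an intersection of half-spaces [dot (a i) x <= b i] in
   which the normals of the constraints active at any point are linearly
   independent; its facets are then the nonempty [side]s and its vertices the
   points with n active constraints. If the labels l_1, .., l_n at some vertex
   do not form a basis of Z^n, then some nonzero vector sum_j c_j l_j with
   0 <= c_j < 1 is integral; dividing it by an integer gives a primitive u whose
   coefficients still lie in [0, 1[. Blow up the face on which the facets with
   c_j != 0 meet, and label the new facet u. A vertex of that face with labels
   of determinant D is replaced by vertices at which one l_j is exchanged for u,
   hence of determinant c_j D with 0 < |c_j D| < |D|. As each vertex gives rise
   to at most n new ones, the sum of (n + 1)^|D| over the vertices decreases, so
   that after finitely many steps all determinants are 1 or -1. *)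
Require Import Defs.
From mathcomp Require Import all_boot all_order all_algebra.
From mathcomp Require Import all_classical all_reals all_analysis.
From mathcomp Require Import ring zify.
Import Order.TTheory GRing.Theory Num.Theory.

Set Implicit Arguments.
Unset Strict Implicit.
Unset Printing Implicit Defensive.

Local Open Scope classical_set_scope.
Local Open Scope card_scope.
Local Open Scope ring_scope.

(** * Half-spaces and extreme points *)

Section Presentation.
Context (R : realType) (n : nat).

Lemma dot0 (a : 'rV[R]_n) : dot a 0 = 0.
Proof. by rewrite /dot big1 // => j _; rewrite mxE mulr0. Qed.

Lemma dotN (a x : 'rV[R]_n) : dot a (- x) = - dot a x.
Proof. by rewrite -scaleN1r dotZ mulN1r. Qed.

Lemma dotB (a x y : 'rV[R]_n) : dot a (x - y) = dot a x - dot a y.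
Proof. by rewrite dotD dotN. Qed.

Lemma dot_mul (a x : 'rV[R]_n) : x *m a^T = (dot a x)%:M.
Proof.
apply/matrixP => i j; rewrite !ord1 !mxE eqxx mulr1n.
by apply: eq_bigr => k _; rewrite mxE mulrC.
Qed.

Variables (I : finType) (a : I -> 'rV[R]_n) (b : I -> R).

Definition halfspaces : set 'rV[R]_n := [set x | forall i, dot (a i) x <= b i].

Definition active (x : 'rV[R]_n) : pred I := fun i => dot (a i) x == b i.

Definition side (i : I) : set 'rV[R]_n :=
  halfspaces `&` [set x | dot (a i) x = b i].

(* Dual form of the linear independence of the normals active at [x]. *)
Definition nondegenerate : Prop :=
  forall x, halfspaces x -> forall t : I -> R,
  exists d, forall i, active x i -> dot (a i) d = t i.

Definition extreme (v : 'rV[R]_n) : Prop :=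
  halfspaces v /\ forall d, (forall i, active v i -> dot (a i) d = 0) -> d = 0.

(** Inactive constraints have slack, and there are finitely many of them and of directions, so one
    step length serves all. *)
Lemma small_move (J : finType) (d : J -> 'rV[R]_n) x : halfspaces x ->
  (forall j i, active x i -> dot (a i) (d j) <= 0) ->
  exists2 e, 0 < e & forall j, halfspaces (x + e *: d j) /\
    forall i, ~~ active x i -> dot (a i) (x + e *: d j) < b i.
Proof.
move=> Px ad.
(* The slack is divided by more than the growth along the direction: this keeps the inequality
   strict and the denominator positive. *)
pose e k : R := if active x k.2 then 1 else
  (b k.2 - dot (a k.2) x) / (`|dot (a k.2) (d k.1)| + 1).
have den (y : R) : 0 < `|y| + 1 by rewrite ltr_wpDl.
have e0 k : 0 < e k.
  rewrite /e; case: ifPn => // nk; apply: divr_gt0 => //.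
  by rewrite subr_gt0 lt_neqAle nk/=; exact: Px.
pose m := \big[Num.min/1]_(k : J * I) e k.
have m0 : 0 < m by rewrite /m; elim/big_ind: _ => // u v u0 v0; rewrite lt_min u0.
have small j i : ~~ active x i -> dot (a i) (x + m *: d j) < b i.
  move=> ni; rewrite dotD dotZ -ltrBrDl.
  have : m <= e (j, i) by apply: bigmin_le_cond.
  rewrite /e /= (negPf ni) ler_pdivlMr// => h.
  apply: lt_le_trans h; rewrite mulrDr mulr1.
  by apply: ltr_pwDr => //; rewrite ler_pM2l// ler_norm.
exists m => // j; split; last exact: small.
move=> i; case: (boolP (active x i)) => [xi|ni]; last exact/ltW/small.
by rewrite dotD dotZ (eqP xi) gerDl pmulr_rle0 ?ad.
Qed.

Lemma small_move1 (d : 'rV[R]_n) x : halfspaces x ->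
  (forall i, active x i -> dot (a i) d <= 0) ->
  exists2 e, 0 < e & halfspaces (x + e *: d) /\
    forall i, ~~ active x i -> dot (a i) (x + e *: d) < b i.
Proof.
move=> Px ad; have [|e e0 h] := @small_move unit (fun=> d) x Px; first by [].
by exists e => //; exact: h tt.
Qed.

Lemma bounded_ray (x d : 'rV[R]_n) (Q : set 'rV[R]_n) : bounded_set Q ->
  (forall t, 0 <= t -> Q (x + t *: d)) -> d = 0.
Proof.
move=> [M [Mreal MQ]] Qr; apply: contrapT => /eqP d0.
have d0' : 0 < `|d| by rewrite normr_gt0.
(* This gives [t *: d] a norm exceeding by one what the bound [|M| + 1] on the set allows. *)
pose t := (`|M| + 2 + `|x|) / `|d|.
have t0 : 0 <= t by rewrite divr_ge0 ?addr_ge0.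
have M1 : M < `|M| + 1 by rewrite ltr_pwDr// ler_norm.
have := MQ _ M1 _ (Qr _ t0); rewrite /= => le1.
have : `|t *: d| <= `|x + t *: d| + `|x|.
  by rewrite -{1}(addKr x (t *: d)) addrC (le_trans (ler_normB _ _)).
rewrite normrZ (ger0_norm t0) divfK ?gt_eqF// lerD2r => /le_trans/(_ le1).
by rewrite lerD2l lern1.
Qed.

(* Among the points of [halfspaces] with at least the active constraints of [x]
   and at least its value of [dot al], one with the most active constraints is
   extreme: along a direction killed by its active normals one could otherwise
   move on until a further constraint becomes active. *)
Lemma extreme_above (al x : 'rV[R]_n) : bounded_set halfspaces -> halfspaces x ->
  exists v, [/\ extreme v, forall i, active x i -> active v i &
                dot al x <= dot al v].
Proof.
move=> bP Px.
pose Q k := `[< exists v, [/\ halfspaces v, forall i, active x i -> active v i,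
                 dot al x <= dot al v & (k <= #|active v|)%N] >].
have Q0 : exists k, Q k by exists 0%N; apply/asboolP; exists x.
have QI k : Q k -> (k <= #|I|)%N.
  by move=> /asboolP[v [_ _ _ /leq_trans]]; apply; exact: max_card.
case: (ex_maxnP Q0 QI) => k /asboolP[v [Pv xv av kv]] kmax.
exists v; split => //; split => // d0 vd0; apply: contrapT => d0N.
have [d [vd dN ad]] : exists d, [/\ forall i, active v i -> dot (a i) d = 0,
     d <> 0 & 0 <= dot al d].
  have [d0p|d0n] := leP 0 (dot al d0); first by exists d0.
  exists (- d0); split.
  - by move=> i vi; rewrite dotN vd0 ?oppr0.
  - by move=> /eqP; rewrite oppr_eq0 => /eqP.
  - by rewrite dotN oppr_ge0 ltW.
pose p i := 0 < dot (a i) d.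
pose tm i := (b i - dot (a i) v) / dot (a i) d.
have [[i0 pi0]|np] := pselect (exists i, p i); last first.
  apply: dN; apply: (@bounded_ray v d _ bP) => t t0 i.
  rewrite dotD dotZ; apply: le_trans (Pv i); rewrite gerDl mulr_ge0_le0//.
  by rewrite leNgt; apply/negP => pi; apply: np; exists i.
have tm0 i : p i -> 0 <= tm i.
  by move=> pi; rewrite divr_ge0 ?(ltW pi)// subr_ge0.
case: (Order.TotalTheory.arg_minP tm pi0) => j pj jmin.
have Pw : halfspaces (v + tm j *: d).
  move=> i; rewrite dotD dotZ -lerBrDl; case: (ltP 0 (dot (a i) d)) => di.
    by rewrite -ler_pdivlMr//; exact: jmin.
  by apply: (@le_trans _ _ 0); rewrite ?subr_ge0// mulr_ge0_le0// tm0.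
have vw i : active v i -> active (v + tm j *: d) i.
  by move=> vi; rewrite /active dotD dotZ vd// mulr0 addr0.
suff : (k < k)%N by rewrite ltnn.
apply: kmax; apply/asboolP; exists (v + tm j *: d); split => //.
- by move=> i /xv/vw.
- by rewrite dotD dotZ; apply: le_trans av _; rewrite lerDl mulr_ge0// tm0.
apply: leq_ltn_trans kv _; apply: proper_card; apply/properP; split.
  by apply/fintype.subsetP => i; rewrite !unfold_in; exact: vw.
exists j; rewrite unfold_in /active.
  by rewrite dotD dotZ divfK ?(gt_eqF pj)// addrC subrK.
by apply/negP => vj; move: pj; rewrite /p (vd _ vj) ltxx.
Qed.

Lemma dot_sumpl (J : finType) (Q : pred J) (u : J -> 'rV[R]_n) x :
  dot (\sum_(j | Q j) u j) x = \sum_(j | Q j) dot (u j) x.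
Proof.
rewrite /dot exchange_big; apply: eq_bigr => j _.
by rewrite summxE mulr_suml.
Qed.

(** A direction killed by the active normals can be followed a little both ways, so it cannot leave
    a face reduced to [v]. Conversely, the sum of the active normals exposes the points where all
    these constraints stay active, hence only [v]. *)
Lemma extremeP v : vertices halfspaces v <-> extreme v.
Proof.
split=> [[_ [al [c [Pc vE]]]]|[Pv vd]].
  have [Pv av] : halfspaces v /\ dot al v = c.
    by have : [set v] v by []; rewrite {1}vE.
  split => // d ad.
  have move_zero d' : (forall i, active v i -> dot (a i) d' = 0) ->
      exists2 e, 0 < e & halfspaces (v + e *: d').
    move=> ad'; have [|e e0 [h _]] := @small_move1 d' v Pv; last by exists e.
    by move=> i vi; rewrite ad'.
  have le0 d' : (forall i, active v i -> dot (a i) d' = 0) -> dot al d' <= 0.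
    move=> /move_zero[e e0 /Pc]; rewrite dotD dotZ av gerDl.
    by rewrite pmulr_rle0.
  have ad0 : dot al d = 0.
    apply/eqP; rewrite eq_le le0//= -oppr_le0 -dotN; apply: le0 => i vi.
    by rewrite dotN ad ?oppr0.
  have [e e0 Pw] := move_zero _ ad.
  have : [set v] (v + e *: d).
    by rewrite vE; split => //=; rewrite dotD dotZ ad0 mulr0 addr0.
  move=> /= /(canRL (addKr v)); rewrite addNr => /eqP.
  by rewrite scaler_eq0 gt_eqF//= => /eqP.
split; first by exists v.
exists (\sum_(i | active v i) a i), (\sum_(i | active v i) b i); split.
  by move=> x Px; rewrite dot_sumpl; apply: ler_sum => i _; exact: Px.
apply/seteqP; split => [_ ->|y [Py yE]] /=.
  by split => //=; rewrite dot_sumpl; apply: eq_bigr => i /eqP.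
apply/subr0_eq/vd => i vi; apply/eqP; rewrite dotB subr_eq0 (eqP vi).
rewrite eq_le Py leNgt; apply/negP => lt.
have : dot (\sum_(i | active v i) a i) y < \sum_(i | active v i) b i.
  rewrite dot_sumpl (bigD1 i)//= [ltRHS](bigD1 i)//=.
  by apply: ltr_leD => //; apply: ler_sum => k _; exact: Py.
by rewrite yE ltxx.
Qed.

(** The dual vectors given by nondegeneracy form a right inverse of the matrix of active normals,
    whose rank is then its number of rows. *)
Lemma nondegenerate_card x : nondegenerate -> halfspaces x ->
  (#|active x| <= n)%N.
Proof.
move=> nd Px; pose M := \matrix_(k < #|active x|) a (enum_val k).
have /choice[d dP] : forall k : 'I_#|active x|, exists d,
    forall i, active x i -> dot (a i) d = (i == enum_val k)%:R.
  by move=> k; exact: nd.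
suff <- : \rank M = #|active x| by exact: rank_leq_col.
apply/eqP/row_freeP; exists (\matrix_k d k)^T; apply/matrixP => k l.
have := dP l (enum_val k) (enum_valP k); rewrite (inj_eq enum_val_inj) => kl.
by rewrite [in RHS]mxE -kl mxE; apply: eq_bigr => j _; rewrite !mxE.
Qed.

(** Extremality makes the active normals span the space; if there are at most [n], they form an
    invertible matrix. *)
Lemma extreme_dual v : extreme v -> (#|active v| <= n)%N ->
  #|active v| = n /\
  forall t : I -> R, exists d, forall i, active v i -> dot (a i) d = t i.
Proof.
move=> [Pv vd] le; pose M := \matrix_(k < #|active v|) a (enum_val k).
have MTE d k : (d *m M^T) 0 k = dot (a (enum_val k)) d.
  by rewrite !mxE; apply: eq_bigr => j _; rewrite !mxE mulrC.
have rM : row_free M^T.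
  rewrite -kermx_eq0; apply/eqP/row_matrixP => r; rewrite row0.
  apply: vd => i vi; have := MTE (row r (kermx M^T)) (enum_rank_in vi i).
  by rewrite enum_rankK_in// => <-; rewrite -row_mul mulmx_ker row0 mxE.
have cn : #|active v| = n.
  by apply/eqP; rewrite eqn_leq le/= -(eqP rM) rank_leq_col.
have /row_fullP[B BM] : row_full M^T by rewrite /row_full (eqP rM) cn.
split => // t; exists ((\row_k t (enum_val k)) *m B) => i vi.
have := MTE ((\row_k t (enum_val k)) *m B) (enum_rank_in vi i).
by rewrite -mulmxA BM mulmx1 mxE !enum_rankK_in.
Qed.

Lemma extreme_card v : nondegenerate -> extreme v -> #|active v| = n.
Proof.
by move=> nd vex; case: (extreme_dual vex (nondegenerate_card nd vex.1)).
Qed.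

Lemma has_dim_interior x : halfspaces x -> (forall i, dot (a i) x < b i) ->
  has_dim halfspaces n.
Proof.
move=> Px xlt.
have [j i|e e0 eP] := @small_move _ (fun j : 'I_n => delta_mx 0 j) x Px.
  by rewrite /active lt_eqF.
exists x, (e *: 1%:M); split => //.
- by move=> i; rewrite linearZ /= rowE mulmx1; case: (eP i).
- by rewrite row_free_unit unitmxZ ?unitmx1// unitfE gt_eqF.
- move=> y _; apply: submx_full; rewrite row_full_unit unitmxZ ?unitmx1//.
  by rewrite unitfE gt_eqF.
Qed.

(** Where only constraint [i] is active, small multiples of a basis of the hyperplane orthogonal to
    [a i] stay in the side. *)
Lemma has_dim_side x i : halfspaces x -> a i != 0 ->
  (forall j, active x j = (j == i)) -> exists2 k, k.+1 = n & has_dim (side i) k.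
Proof.
move=> Px ai0 xi; pose K := row_base (kermx (a i)^T).
have KE : (K :=: kermx (a i)^T)%MS by exact: eq_row_base.
have aiK k : dot (a i) (row k K) = 0.
  have : row k K *m (a i)^T = 0.
    by apply/sub_kermxP; rewrite -KE row_sub.
  by rewrite dot_mul => /matrixP/(_ 0 0); rewrite !mxE eqxx mulr1n.
have rK : (\rank (kermx (a i)^T)).+1 = n.
  rewrite mxrank_ker mxrank_tr rank_rV ai0 subn1 prednK//.
  by move: ai0; case: (n) (a i) => // u; rewrite thinmx0 eqxx.
exists (\rank (kermx (a i)^T)) => //.
have [k j|e e0 eP] := @small_move _ (fun k => row k K) x Px.
  by rewrite xi => /eqP ->; rewrite aiK.
have xiE : dot (a i) x = b i by apply/eqP; rewrite -[_ == _]/(active x i) xi.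
exists x, (e *: K); split => //.
- move=> k; rewrite linearZ /=; case: (eP k) => ? _; split => //=.
  by rewrite dotD dotZ aiK mulr0 addr0.
- by rewrite /row_free mxrank_scale_nz ?(gt_eqF e0)// KE.
- move=> y [Py /= yE].
  apply: (@submx_trans _ _ _ _ _ _ K); last first.
    by rewrite (eqmx_scale _ (lt0r_neq0 e0)).
  rewrite KE; apply/sub_kermxP.
  by rewrite dot_mul dotB xiE yE subrr raddf0.
Qed.

Lemma dotC (x y : 'rV[R]_n) : dot x y = dot y x.
Proof. by apply: eq_bigr => j _; rewrite mulrC. Qed.

Lemma has_dim_le (F : set 'rV[R]_n) k l : has_dim F k -> has_dim F l -> (k <= l)%N.
Proof.
move=> [x [B [Fx FB rB _]]] [y [C [_ _ _ FC]]].
rewrite -(eqP rB : \rank B = k); apply: leq_trans (rank_leq_row C).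
apply/mxrankS/row_subP => i.
have -> : row i B = (x + row i B - y) - (x - y).
  by rewrite opprB addrA subrK addrC addKr.
by rewrite addmx_sub ?eqmx_opp ?FC.
Qed.

Lemma has_dim_uniq (F : set 'rV[R]_n) k l : has_dim F k -> has_dim F l -> k = l.
Proof.
by move=> Fk Fl; apply/eqP; rewrite eqn_leq (has_dim_le Fk Fl) (has_dim_le Fl Fk).
Qed.

Lemma facet_side_point x i : has_dim halfspaces n -> halfspaces x -> a i != 0 ->
  (forall j, active x j = (j == i)) -> facet halfspaces (side i).
Proof.
move=> Pn Px ai0 xi; split; last first.
  by have [k kn Fk] := has_dim_side Px ai0 xi; exists k; rewrite kn.
split; last by exists (a i), (b i); split => // y Py; exact: Py.
by exists x; split => //=; apply/eqP; rewrite -[_ == _]/(active x i) xi.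
Qed.

Hypothesis nd : nondegenerate.

(** Nondegeneracy yields a direction constant on the constraints in [A] and decreasing on the other
    active ones; a short step along it releases exactly the latter. *)
Lemma shrink_active x (A : pred I) : halfspaces x ->
  (forall i, A i -> active x i) ->
  exists2 y, halfspaces y & forall i, active y i = A i.
Proof.
move=> Px Ax; have [d dx] := nd Px (fun i => if A i then 0 else -1).
have [i xi|e e0 [Py ys]] := @small_move1 d x Px.
  by rewrite dx//; case: ifP; rewrite ?lerN10.
exists (x + e *: d) => // i; case: (boolP (active x i)) => [xi|nxi].
  rewrite /active dotD dotZ (eqP xi) dx// -subr_eq0 addrAC subrr add0r.
  by case: (A i); rewrite ?mulr0 ?eqxx// mulrN1 oppr_eq0 gt_eqF.
by rewrite /active lt_eqF ?ys//; apply/esym/negbTE; apply: contra nxi; exact: Ax.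
Qed.

Lemma active_neq0 x i : halfspaces x -> active x i -> a i != 0.
Proof.
move=> Px xi; have [d dx] := nd Px (fun=> 1); apply/eqP => a0.
have := dx i xi; rewrite a0 /dot big1 => [/esym/eqP|j _].
  by rewrite oner_eq0.
by rewrite mxE mul0r.
Qed.

Lemma has_dim_halfspaces : halfspaces !=set0 -> has_dim halfspaces n.
Proof.
move=> [x Px]; have [|y Py yA] := @shrink_active x pred0 Px; first by [].
apply: (has_dim_interior Py) => i.
by rewrite lt_neqAle Py andbT; apply/negbT; exact: yA.
Qed.

Lemma side_point x i : side i x ->
  exists2 y, halfspaces y & forall j, active y j = (j == i).
Proof.
by move=> [Px /= /eqP xi]; apply: (shrink_active Px) => j /eqP ->.
Qed.

Lemma facet_side x i : side i x -> facet halfspaces (side i).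
Proof.
move=> xi; have [y Py yi] := side_point xi.
apply: (facet_side_point _ Py _ yi); first by apply: has_dim_halfspaces; exists y.
by apply: (active_neq0 Py); rewrite yi.
Qed.

Lemma side_inj x i j : side i x -> side i = side j -> i = j.
Proof.
move=> xi ij; have [y Py yi] := side_point xi.
have : side i y by split => //=; apply/eqP; rewrite -[_ == _]/(active y i) yi.
by rewrite ij => -[_ /= /eqP]; rewrite -[_ == _]/(active y j) yi => /eqP ->.
Qed.

(** The functional exposing [F] is a nonnegative combination of active normals, so [F] lies in every
    side with nonzero coefficient. There is such a side, as [F] is proper, and no second one, as [F]
    has codimension one. *)
Lemma facetE F : facet halfspaces F -> exists2 i, F !=set0 & F = side i.
Proof.
move=> [[F0 [al [c [Pc FE]]]] [k [Fk Pk]]]; have [x Fx] := F0.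
have [Px alx] : halfspaces x /\ dot al x = c by move: Fx; rewrite FE.
have kn : k.+1 = n.
  by apply: (has_dim_uniq Pk); apply: has_dim_halfspaces; exists x.
have le0 d : (forall j, active x j -> dot (a j) d <= 0) -> dot al d <= 0.
  move=> dx; have [e e0 [Py _]] := small_move1 Px dx.
  by have := Pc _ Py; rewrite dotD dotZ alx gerDl pmulr_rle0.
have eq0 d : (forall j, active x j -> dot (a j) d = 0) -> dot al d = 0.
  move=> dx; apply/eqP; rewrite eq_le le0//= => [|j /dx -> //].
  by rewrite -oppr_le0 -dotN le0// => j /dx; rewrite dotN => ->; rewrite oppr0.
have /choice[d dP] : forall i, exists d,
    forall j, active x j -> dot (a j) d = - (j == i)%:R by move=> i; exact: nd.
(* [al] is the nonnegative combination of the active normals with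
   coefficients [- dot al (d i)]. *)
have alE y : dot al y = \sum_(i | active x i) - dot al (d i) * dot (a i) y.
  have := eq0 (y + \sum_(i | active x i) dot (a i) y *: d i).
  have dsum u (w : I -> R) : dot u (\sum_(i | active x i) w i *: d i) =
      \sum_(i | active x i) w i * dot u (d i).
    elim/big_rec2: _ => [|i p q _ <-]; first exact: dot0.
    by rewrite dotD dotZ.
  rewrite dotD dsum => /(_ _)/eqP; rewrite addr_eq0 => h.
  rewrite (eqP (h _)) => [|j xj].
    by rewrite -sumrN; apply: eq_bigr => i _; rewrite mulNr mulrC.
  rewrite dotD dsum (bigD1 j)//= big1 => [|i /andP[_ ij]].
    by rewrite addr0 dP// eqxx mulrN1 subrr.
  by rewrite dP// eq_sym (negPf ij) oppr0 mulr0.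
have mu0 i : active x i -> dot al (d i) <= 0.
  by move=> xi; apply: le0 => j xj; rewrite dP// oppr_le0 ler0n.
have sub i : active x i -> dot al (d i) != 0 -> F `<=` side i.
  move=> xi mui y; rewrite FE => -[Py /= aly]; split => //=; apply/eqP.
  rewrite eq_le Py/= leNgt; apply/negP => lt.
  suff : dot al (y - x) < 0 by rewrite dotB aly alx subrr ltxx.
  rewrite alE (bigD1 i)//= -[ltRHS]addr0 ltr_leD//.
    rewrite mulNr oppr_lt0 nmulr_rgt0 ?dotB ?(eqP xi) ?subr_lt0//.
    by rewrite lt_neqAle mui mu0.
  apply: sumr_le0 => j /andP[xj _]; rewrite mulNr oppr_le0 mulr_le0 ?mu0//.
  by rewrite dotB (eqP xj) subr_le0; exact: Py.
have [i xi mui] : exists2 i, active x i & dot al (d i) != 0.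
  apply: contrapT => h; have al0 y : dot al y = 0.
    rewrite alE big1// => i xi; apply/eqP; rewrite mulNr oppr_eq0 mulf_eq0.
    by apply/orP; left; apply/negPn/negP => mui; apply: h; exists i.
  have FP : F = halfspaces.
    by rewrite FE; apply/seteqP; split=> [y []//|y Py]; split=> //=; rewrite al0 -alx.
  by move: Fk; rewrite FP => /has_dim_uniq/(_ Pk)/eqP; rewrite ltn_eqF.
exists i => //; apply/seteqP; split; first exact: sub.
move=> y [Py /= yi]; rewrite FE; split => //=.
apply/eqP; rewrite -alx -subr_eq0 -dotB alE (bigD1 i)//= dotB yi (eqP xi) subrr.
rewrite mulr0 add0r big1// => j /andP[xj ji]; apply/eqP.
rewrite mulNr oppr_eq0 mulf_eq0; apply/orP; left; apply/negPn/negP => muj.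
(* Two independent normals would vanish on the directions of [F], so that [k + 2 <= n]. *)
have [x0 [B [Fx0 FB rB _]]] := Fk.
pose M := col_mx (a i) (a j).
have BM0 u : F `<=` side u -> B *m (a u)^T = 0.
  move=> Fu; apply/row_matrixP => r; rewrite row_mul row0 dot_mul.
  have [_ /= e1] := Fu _ (FB r); have [_ /= e2] := Fu _ Fx0.
  by move: e1; rewrite dotD e2 => /(canRL (addKr _)); rewrite addNr => ->; rewrite raddf0.
have : (B <= kermx M^T)%MS.
  by apply/sub_kermxP; rewrite tr_col_mx mul_mx_row !BM0 ?row_mx0//; exact: sub.
move=> /mxrankS; rewrite mxrank_ker mxrank_tr (eqP rB : \rank B = k).
suff rM : \rank M = 2 by have := rank_leq_col M; rewrite rM -kn; lia.
apply/eqP/row_freeP; exists (row_mx (- d i)^T (- d j)^T).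
have aD u v : active x u -> a u *m (- d v)^T = ((u == v)%:R : R)%:M.
  by move=> xu; rewrite dot_mul dotC dotN dP// opprK.
rewrite mul_col_row !aD// !eqxx (negPf ji) eq_sym (negPf ji) raddf0.
by rewrite [RHS]scalar_mx_block.
Qed.

End Presentation.

(** * Simple polytopes and nondegenerate presentations *)

Lemma card_set_pred (T : finType) (A : pred T) : [set i | A i] #= `I_#|A|.
Proof.
have inj : {in [set i | A i] &, injective (fun i => index i (enum A))}.
  move=> i j /set_mem Ai /set_mem Aj; apply: (@index_inj _ i).
  - by rewrite mem_enum.
  - by rewrite mem_enum.
have := inj_card_eq inj; rewrite card_eq_sym => /card_eq_trans; apply.
suff -> : [set index i (enum A) | i in [set i | A i]] = `I_#|A| by [].
apply/seteqP; split => [_ [i Ai <-]|k /= kA]; first by rewrite /= cardE index_mem mem_enum.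
exists (enum_val (Ordinal kA)); first exact: enum_valP.
by rewrite /enum_val index_uniq ?enum_uniq// -cardE.
Qed.

Lemma polytope_halfspaces (R : realType) n (I : finType) (a : I -> 'rV[R]_n) b :
  bounded_set (halfspaces a b) -> polytope (halfspaces a b).
Proof.
move=> bP; split => //.
exists #|I|, (fun k => a (enum_val k)), (fun k => b (enum_val k)).
apply/seteqP; split => x Px i; first exact: Px.
by have := Px (enum_rank i); rewrite enum_rankK.
Qed.

(** The facets at a vertex are the sides of its [n] active constraints, and extremality says that
    these meet only there. *)
Lemma simple_halfspaces (R : realType) n (I : finType) (a : I -> 'rV[R]_n) b :
  bounded_set (halfspaces a b) -> halfspaces a b !=set0 -> nondegenerate a b ->
  simple_polytope (halfspaces a b).
Proof.
move=> bP P0 nd; split; [exact: polytope_halfspaces|exact: has_dim_halfspaces|].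
move=> v /extremeP vex; have [Pv vd] := vex.
have sv i : active a b v i -> side a b i v by move=> /eqP.
have fvE : facets_at (halfspaces a b) v = [set side a b i | i in [set i | active a b v i]].
  apply/seteqP; split => [F [/(facetE nd)[i _ ->] [_ /= /eqP vi]]|F [i /= vi <-]].
    by exists i.
  by split; [exact: facet_side (sv _ vi)|exact: sv].
split.
  have <- : `I_#|active a b v| = `I_n by rewrite (extreme_card nd vex).
  rewrite fvE; apply: card_eq_trans (card_set_pred _).
  apply: inj_card_eq => i j /set_mem /= vi _; exact: side_inj (sv _ vi).
apply/seteqP; split => [y [Py yF]|_ ->] /=; last by split => // F [].
apply/subr0_eq/vd => i vi; rewrite dotB.
have [_ /= ->] : side a b i y.
  by apply: yF; split; [exact: facet_side (sv _ vi)|exact: sv].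
by rewrite (eqP vi) subrr.
Qed.

(** The barycentre of an affine basis works: a constraint active there would be active on the whole
    basis, forcing its normal to vanish. *)
Lemma interior_point (R : realType) n (I : finType) (a : I -> 'rV[R]_n) b :
  has_dim (halfspaces a b) n -> (forall i, a i != 0) ->
  exists z, forall i, dot (a i) z < b i.
Proof.
move=> [x [B [Px PB rB _]]] a0.
exists (x + n.+1%:R^-1 *: \sum_j row j B) => i.
have n0 : (0 : R) < n.+1%:R by rewrite ltr0n.
rewrite ltNge dotD dotZ dot_sum -lerBlDl ler_pdivlMl//; apply/negP => h.
have rle j : dot (a i) (row j B) <= b i - dot (a i) x.
  by rewrite lerBrDl -dotD; exact: PB.
have : \sum_j dot (a i) (row j B) <= (b i - dot (a i) x) *+ n.
  rewrite -[X in _ *+ X]card_ord -sumr_const; apply: ler_sum => j _; exact: rle.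
move=> /(le_trans h); rewrite mulr_natl mulrS gerDr => s0.
have s1 : b i - dot (a i) x = 0.
  by apply/eqP; rewrite eq_le s0/= subr_ge0; exact: Px.
have rle0 j : dot (a i) (row j B) <= 0 by rewrite -s1.
have sum0 : \sum_j - dot (a i) (row j B) = 0.
  apply/eqP; rewrite sumrN oppr_eq0 eq_le sumr_le0//=.
  by move: h; rewrite s1 mulr0.
have r0 j : dot (a i) (row j B) = 0.
  by apply/eqP; rewrite -oppr_eq0 (psumr_eq0P _ sum0)// => k _; rewrite oppr_ge0.
have : B *m (a i)^T = 0.
  by apply/row_matrixP => k; rewrite row_mul row0 dot_mul r0 raddf0.
move=> /(congr1 (mulmx (invmx B))); rewrite mulKmx -?row_free_unit// mulmx0.
by move=> /(congr1 trmx)/eqP; rewrite trmxK trmx0 (negPf (a0 i)).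
Qed.

(** In a presentation with fewest half-spaces every constraint is alone active somewhere, so its
    side is a facet and distinct constraints have distinct sides. Simplicity then allows at most [n]
    active constraints at a vertex, which makes them independent, and the active constraints of any
    point are among those of a vertex. *)
Lemma simple_polytope_presentation (R : realType) n (P : set 'rV[R]_n) :
  simple_polytope P -> exists m (a : 'I_m -> 'rV[R]_n) (b : 'I_m -> R),
    P = halfspaces a b /\ nondegenerate a b.
Proof.
move=> [[bP [m0 [a0 [b0 PE0]]]] Pn Pv].
pose Q m := `[< exists (a : 'I_m -> 'rV[R]_n) b, P = halfspaces a b >].
have Q0 : exists m, Q m by exists m0; apply/asboolP; exists a0, b0.
case: (ex_minnP Q0) => m /asboolP[a [b PE]] mmin.
exists m, a, b; split => //.
have irr i : exists2 y, forall j, j != i -> dot (a j) y <= b j & b i < dot (a i) y.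
  apply: contrapT => h; case: m a b PE mmin i h => [|m] a b PE mmin i h; first by case: i h.
  suff /mmin : Q m by rewrite ltnn.
  apply/asboolP; exists (fun j => a (lift i j)), (fun j => b (lift i j)).
  rewrite PE; apply/seteqP; split => [x Px j|x Px j]; first exact: Px.
  case: (unliftP i j) => [j' ->|->]; first exact: Px.
  rewrite leNgt; apply/negP => lt; apply: h; exists x => // j'.
  by rewrite eq_sym => /unlift_some[k -> _]; exact: Px.
rewrite {}PE in bP Pn Pv *.
have [x0 Px0] : halfspaces a b !=set0 by case: Pn => x [B [? _ _ _]]; exists x.
have an0 i : a i != 0.
  apply/eqP => ai0; have [y _] := irr i; have := Px0 i.
  by rewrite ai0 ![dot 0 _]dotC !dot0 => /le_lt_trans h /h; rewrite ltxx.
have [z zlt] := interior_point Pn an0.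
have wit i : exists2 w, halfspaces a b w & forall j, active a b w j = (j == i).
  have [y yle ygt] := irr i.
  have yz : 0 < dot (a i) y - dot (a i) z by rewrite subr_gt0; apply: lt_trans ygt.
  (* The segment from the interior point [z] to [y], which violates constraint [i] alone, crosses
     the hyperplane of that constraint at parameter [t]. *)
  pose t := (b i - dot (a i) z) / (dot (a i) y - dot (a i) z).
  have t0 : 0 < t by rewrite divr_gt0// subr_gt0.
  have t1 : t < 1 by rewrite ltr_pdivrMr// mul1r ltrD2r.
  have wi : dot (a i) (z + t *: (y - z)) = b i.
    by rewrite dotD dotZ dotB divfK ?gt_eqF// addrC subrK.
  have wj j : j != i -> dot (a j) (z + t *: (y - z)) < b j.
    move=> ji; rewrite dotD dotZ dotB.
    have -> : dot (a j) z + t * (dot (a j) y - dot (a j) z) =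
              (1 - t) * dot (a j) z + t * dot (a j) y by ring.
    have -> : b j = (1 - t) * b j + t * b j by ring.
    by rewrite ltr_leD ?ltr_pM2l ?ler_pM2l ?subr_gt0// yle.
  exists (z + t *: (y - z)) => j; have [->|ji] := eqVneq j i.
  - by rewrite wi.
  - exact/ltW/wj.
  - by rewrite /active wi eqxx.
  - by rewrite /active lt_eqF ?wj.
move=> x Px t; have [v [vex xv _]] := @extreme_above _ _ _ _ _ 0 x bP Px.
suff av : (#|active a b v| <= n)%N.
  by have [_ /(_ t)[d dv]] := extreme_dual vex av; exists d => i /xv/dv.
have [cv _] := Pv v ((extremeP _ _ _).2 vex).
have inj : {in [set i | active a b v i] &, injective (side a b)}.
  move=> i j _ _ ij; have [w Pw wi] := wit i.
  have : side a b i w by split => //=; apply/eqP; rewrite -[_ == _]/(active a b w i) wi.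
  by rewrite ij => -[_ /= /eqP]; rewrite -[_ == _]/(active a b w j) wi => /eqP ->.
rewrite -card_le_II -(card_le_eql (card_set_pred (active a b v))).
rewrite -(card_le_eql (inj_card_eq inj)) -(card_le_eqr cv).
apply: subset_card_le => F [i /= vi <-].
have [w Pw wi] := wit i; split; last by split; [exact: vex.1|exact/eqP].
exact: facet_side_point Pn Pw (an0 i) wi.
Qed.

(** * Labels at the vertices *)

Section Frames.
Context (R : realType) (n : nat) (I : finType).
Variables (a : I -> 'rV[R]_n) (b : I -> R).
Variable lam : set 'rV[R]_n -> 'rV[int]_n.
Hypotheses (bP : bounded_set (halfspaces a b)) (nd : nondegenerate a b).

(* All orderings of the facets at a vertex are frames, so that determinants can
   be formed without choosing one. *)
Definition frame (f : {ffun 'I_n -> I}) : Prop :=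
  injective f /\ exists2 x, halfspaces a b x & forall k, active a b x (f k).

Definition frame_mx (f : {ffun 'I_n -> I}) : 'M[int]_n :=
  \matrix_k lam (side a b (f k)).

(** From a common point of the facets one reaches a vertex where they are still active; its [n]
    facets form the frame. *)
Lemma frame_facets k (F : 'I_k -> set 'rV[R]_n) : halfspaces a b !=set0 ->
  injective F -> (forall j, facet (halfspaces a b) (F j)) ->
  \bigcap_j F j !=set0 ->
  exists (f : {ffun 'I_n -> I}) (h : 'I_k -> 'I_n),
    [/\ frame f, injective h & forall j, F j = side a b (f (h j))].
Proof.
move=> [x0 Px0] Finj Ff [x xF].
have /choice[g gP] : forall j, exists i, F j = side a b i.
  by move=> j; have [i _ ->] := facetE nd (Ff j); exists i.
have ginj : injective g by move=> j l gjl; apply: Finj; rewrite !gP gjl.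
(* For [k = 0] the intersection is the whole space, so [x] may lie outside the polytope and [x0]
   replaces it. *)
have [y Py yg] : exists2 y, halfspaces a b y & forall j, active a b y (g j).
  have xg j : side a b (g j) x by rewrite -gP; exact: xF.
  case: (k) g xg {F Finj Ff xF gP ginj} => [|k'] g xg; first by exists x0 => // -[].
  by exists x => [|j]; [case: (xg ord0)|apply/eqP; case: (xg j)].
have [v [vex yv _]] := extreme_above 0 bP Py.
have cv := extreme_card nd vex.
exists [ffun k => enum_val (cast_ord (esym cv) k)].
exists (fun j => cast_ord cv (enum_rank_in (yv _ (yg j)) (g j))); split.
- split => [k1 k2|]; first by rewrite !ffunE => /enum_val_inj/cast_ord_inj.
  exists v; first exact: vex.1.
  by move=> l; rewrite ffunE; exact: (enum_valP (cast_ord (esym cv) l)).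
- move=> j l /cast_ord_inj/(congr1 enum_val).
  by rewrite !enum_rankK_in; [exact: ginj|exact: yv|exact: yv].
- by move=> j; rewrite ffunE cast_ordK enum_rankK_in ?gP//; exact: yv.
Qed.

Lemma frame_det_neq0 f : Rcharacteristic (halfspaces a b) lam -> frame f ->
  \det (frame_mx f) != 0.
Proof.
move=> [_ li] [finj [x Px xf]]; have xs k : side a b (f k) x by split => //=; exact/eqP/xf.
apply/negP => /det0P[c c0 cA]; move/eqP: c0; apply.
apply: (li n (fun k => side a b (f k))) => //.
- by move=> k l /(side_inj nd (xs k))/finj.
- by move=> k; exact: facet_side (xs k).
- by exists x => k _; exact: xs.
Qed.

Lemma rowsub_inj_id k (h : 'I_k -> 'I_n) : injective h ->
  rowsub h 1%:M *m (rowsub h 1%:M)^T = 1%:M :> 'M[int]_k.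
Proof.
move=> hinj; apply/matrixP => i j; rewrite !mxE (bigD1 (h i))//= big1 => [|l li].
  by rewrite !mxE eqxx mul1r addr0 (inj_eq hinj) eq_sym.
by rewrite !mxE eq_sym (negPf li) mul0r.
Qed.

Lemma frame_subset_mx k (F : 'I_k -> set 'rV[R]_n)
    (f : {ffun 'I_n -> I}) (h : 'I_k -> 'I_n) :
  (forall j, F j = side a b (f (h j))) ->
  \matrix_j lam (F j) = rowsub h 1%:M *m frame_mx f.
Proof.
move=> Fh; rewrite mul_rowsub_mx mul1mx.
by apply/row_matrixP => j; rewrite rowK row_rowsub rowK Fh.
Qed.

Lemma Rcharacteristic_frames : halfspaces a b !=set0 ->
  (forall i, side a b i !=set0 -> primitive (lam (side a b i))) ->
  (forall f, frame f -> \det (frame_mx f) != 0) ->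
  Rcharacteristic (halfspaces a b) lam.
Proof.
move=> P0 prim fdet; split=> [F Ff|k F Finj Ff F0].
  by have [i F0 FE] := facetE nd Ff; rewrite FE in F0 *; exact: prim.
have [f [h [ff hinj Fh]]] := frame_facets P0 Finj Ff F0.
rewrite (frame_subset_mx Fh) => c; rewrite mulmxA => cA.
have c0 : c *m rowsub h 1%:M = 0.
  apply: contraNeq (fdet f ff) => c0; apply/det0P.
  by exists (c *m rowsub h 1%:M).
by rewrite -[c]mulmx1 -(rowsub_inj_id hinj) mulmxA c0 mul0mx.
Qed.

(** The labels of a frame form a basis of Z^n, so those of the selected facets span a summand, with
    complement spanned by the others. *)
Lemma characteristic_frames : halfspaces a b !=set0 ->
  Rcharacteristic (halfspaces a b) lam ->
  (forall f, frame f -> `|\det (frame_mx f)| = 1) ->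
  characteristic (halfspaces a b) lam.
Proof.
move=> P0 Rlam fdet; split => // k F Finj Ff F0.
have [f [h [ff hinj Fh]]] := frame_facets P0 Finj Ff F0.
rewrite (frame_subset_mx Fh); set A := frame_mx f; set E := rowsub h 1%:M.
have EE : E *m E^T = 1%:M by exact: rowsub_inj_id.
have uA : A \in unitmx.
  have := fdet f ff; rewrite unitmxE -/A; case: (\det A) => [[|[|?]]|[|?]] //.
(* [w *m E^T = 0] says that the coordinates at the selected facets vanish. *)
exists [set u | exists2 w, w *m E^T = 0 & u = w *m A]; split.
- split; first by exists 0; rewrite ?mul0mx.
  move=> _ _ [w wE ->] [w' wE' ->]; exists (w - w').
    by rewrite mulmxBl wE wE' subrr.
  by rewrite mulmxBl.
- apply/seteqP; split => [u [[c _ <-] [w wE]]|_ ->] /=.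
    rewrite mulmxA => /(congr1 (mulmx^~ (invmx A))); rewrite !mulmxK// => cw.
    by rewrite -[c *m E]mulmx1 -[c]mulmx1 -EE mulmxA cw wE !mul0mx.
  by split; exists 0; rewrite ?mul0mx.
- move=> u; pose y := u *m invmx A; exists (y *m E^T *m E *m A), ((y - y *m E^T *m E) *m A).
  split; first by exists (y *m E^T) => //; rewrite mulmxA.
    by exists (y - y *m E^T *m E) => //; rewrite mulmxBl -(mulmxA _ E) EE mulmx1 subrr.
  by rewrite -mulmxDl addrC subrK mulmxKV.
Qed.

Lemma sum_frame (V : zmodType) (f : {ffun 'I_n -> I}) (F : I -> V) : frame f ->
  (forall i, i \notin codom f -> F i = 0) -> \sum_i F i = \sum_k F (f k).
Proof.
move=> [finj _] F0; rewrite (bigID (mem (codom f)))/= [X in _ + X]big1 ?addr0//.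
rewrite -(big_imset (h := f) (A := predT))/=; last by move=> ? ? _ _; exact: finj.
by apply: eq_bigl => i; apply/codomP/imsetP => -[k]; [exists k|move=> _ ->; exists k].
Qed.

End Frames.

(** * Integral vectors with fractional coefficients *)

Lemma primitive_part n (u0 : 'rV[int]_n) : u0 != 0 ->
  exists g u, [/\ 0 < g, u0 = g *: u & primitive u].
Proof.
move=> u00; pose g := \big[gcdn/0%N]_(j < n) absz (u0 0 j).
have gdvd j : (g %| absz (u0 0%R j))%N by exact: biggcdn_inf.
have gdvdz j : (g%:Z %| u0 0%R j)%Z by rewrite dvdzE; exact: gdvd.
have g0 : (0 < g)%N.
  rewrite lt0n; apply: contra_neq u00 => g0; apply/rowP => j.
  by have := gdvd j; rewrite g0 dvd0n absz_eq0 mxE => /eqP.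
exists g%:Z, (\row_j (u0 0%R j %/ g%:Z)%Z); split => //.
  by apply/rowP => j; rewrite !mxE mulrC divzK//; exact: gdvdz.
(* A divisor [d] of the quotient makes [g * d] divide every coordinate of [u0], hence their gcd
   [g]. *)
move=> d w wE; have : (g * absz d %| g)%N.
  apply/dvdn_biggcdP => j _.
  have -> : u0 0 j = g%:Z * d * w 0 j.
    move/rowP/(_ j): wE; rewrite !mxE -mulrA => <-.
    by rewrite mulrC divzK//; exact: gdvdz.
  by rewrite !abszM dvdn_mulr.
rewrite -{2}[g]muln1 dvdn_pmul2l// dvdn1 => /eqP d1.
by rewrite -abszE d1.
Qed.

(** If [D] divided all entries of the adjugate, [A] would be invertible over the integers and [D] a
    unit. So some row of the adjugate has a nonzero reduction [r] modulo [D]; as the adjugate times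
    [A] is [D] times the identity, [D] divides [r *m A]. *)
Lemma fractional_combination n (A : 'M[int]_n) :
  \det A != 0 -> `|\det A| != 1 ->
  exists N (r : 'rV[int]_n) u,
    [/\ forall k, 0 <= r 0 k < N, r != 0, primitive u & N *: u = r *m A].
Proof.
move=> D0 D1; set D := \det A in D0 D1.
have [i [k ndvd]] : exists i k, ~~ (D %| \adj A i k)%Z.
  apply: contrapT => h; move/eqP: D1; apply.
  have dvd i k : (D %| \adj A i k)%Z by apply/negPn/negP => ?; apply: h; exists i, k.
  pose X := \matrix_(i, k) (\adj A i k %/ D)%Z.
  have AX : A *m X = 1%:M.
    have DAX : D *: (A *m X) = D *: 1%:M; last first.
      apply/matrixP => j l; apply: (mulfI D0).
      by have /matrixP/(_ j l) := DAX; rewrite mxE [RHS]mxE.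
    rewrite scalemxAr (_ : D *: X = \adj A); last first.
      by apply/matrixP => j l; rewrite !mxE mulrC divzK//; have := dvd j l; rewrite mxE.
    by rewrite mul_mx_adj scalemx1.
  have := congr1 determinant AX; rewrite det_mulmx det1 -/D => /(congr1 absz).
  by rewrite abszM => /eqP; rewrite muln_eq1 => /andP[/eqP D1 _]; rewrite -abszE D1.
pose r := \row_k (\adj A i k %% D)%Z; pose q := \row_k (\adj A i k %/ D)%Z.
have rq : r = row i (\adj A) - D *: q.
  by apply/rowP => l; rewrite !mxE {2}(divz_eq (cofactor A l i) D) mulrC addrAC subrr add0r.
have rA : r *m A = D *: (delta_mx 0 i - q *m A).
  rewrite rq mulmxBl -row_mul mul_adj_mx scalerBr -scalemxAl; congr (_ - _).
  by rewrite rowE mul_mx_scalar.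
have r0 : r != 0.
  apply: contra ndvd => /eqP/rowP/(_ k); rewrite !mxE => rk.
  by apply/dvdz_mod0P.
pose u0 := Num.sg D *: (delta_mx 0 i - q *m A).
have {}rA : r *m A = `|D| *: u0 by rewrite rA scalerA mulrC -numEsg.
have u00 : u0 != 0.
  apply: contra_neq r0 => u00; apply/eqP/negPn/negP => r0.
  by move/negP: D0; apply; apply/det0P; exists r; rewrite // rA u00 scaler0.
have [g [u [g0 uE pu]]] := primitive_part u00.
(* The content [g] of [u0] goes into [N]; as [g >= 1], the residues stay below [N]. *)
exists (`|D| * g), r, u; split => //; last by rewrite rA uE scalerA.
move=> l; rewrite mxE modz_ge0//=; apply: lt_le_trans (ltz_mod _ D0) _.
by rewrite ler_peMr// -gtz0_ge1.
Qed.

(** Cramer's rule: the cofactors along row [k0] ignore that row, so the adjugate of [A] also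
    computes the determinant of [A']. *)
Lemma det_replace_row (S : comNzRingType) n (A A' : 'M[S]_n) (k0 : 'I_n) N (r : 'rV_n) :
  (forall k, k != k0 -> row k A' = row k A) -> N *: row k0 A' = r *m A ->
  N * \det A' = r 0 k0 * \det A.
Proof.
move=> AA rA; have -> : \det A' = (row k0 A' *m \adj A) 0 k0.
  rewrite (expand_det_row _ k0) !mxE; apply: eq_bigr => j _; rewrite !mxE.
  congr (_ * _); rewrite /cofactor; congr (_ * \det _).
  apply/matrixP => k l; rewrite !mxE.
  have /AA/rowP/(_ (lift j l)) : lift k0 k != k0 by rewrite eq_sym neq_lift.
  by rewrite !mxE.
have := congr1 (fun B => (B *m \adj A) 0 k0) rA.
by rewrite -mulmxA mul_mx_adj mul_mx_scalar -scalemxAl [LHS]mxE [RHS]mxE [RHS]mulrC.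
Qed.

(** * Cutting off a face *)

Section Cut.
Context (R : realType) (n : nat) (I : finType).
Variables (a : I -> 'rV[R]_n) (b : I -> R).
Hypotheses (bP : bounded_set (halfspaces a b)) (nd : nondegenerate a b).
Variables (S : {pred I}) (i0 : I) (x0 : 'rV[R]_n).
Hypotheses (Si0 : i0 \in S) (Px0 : halfspaces a b x0).
Hypothesis (Sx0 : forall i, i \in S -> active a b x0 i).

Definition sum_normal : 'rV[R]_n := \sum_(i in S) a i.
Definition sum_bound : R := \sum_(i in S) b i.
Local Notation al := sum_normal.
Local Notation M := sum_bound.

(** The intersection of the sides indexed by [S], exposed by a single functional that also serves to
    cut it off. *)
Definition common_side : set 'rV[R]_n :=
  halfspaces a b `&` [set x | dot al x = M].

Lemma sum_normal_le x : halfspaces a b x -> dot al x <= M.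
Proof. by move=> Px; rewrite dot_sumpl; apply: ler_sum => i _; exact: Px. Qed.

Lemma sum_normal_eqP x : halfspaces a b x ->
  dot al x = M <-> forall i, i \in S -> active a b x i.
Proof.
move=> Px; split => [alM i Si|Sx]; last first.
  by rewrite dot_sumpl; apply: eq_bigr => i Si; exact/eqP/Sx.
rewrite /active eq_le Px leNgt; apply/negP => lt; suff : dot al x < M by rewrite alM ltxx.
rewrite dot_sumpl /sum_bound (bigD1 i)//= [ltRHS](bigD1 i)//= ltr_leD//.
by apply: ler_sum => j _; exact: Px.
Qed.

Lemma face_common_side : face (halfspaces a b) common_side.
Proof.
split; first by exists x0; split => //; exact/sum_normal_eqP.
by exists al, M; split => // x; exact: sum_normal_le.
Qed.

Lemma extreme_below x : halfspaces a b x ->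
  exists2 v, extreme a b v & dot al v <= dot al x.
Proof.
move=> Px; have [v [vex _]] := extreme_above (- al) bP Px.
by rewrite !(dotC (- _)) !dotN lerN2 ![dot _ al]dotC => vx; exists v.
Qed.

(** An interior point lies strictly below the level [M], and so does a vertex reached by descending
    from it. *)
Lemma extreme_not_common : exists2 v, extreme a b v & dot al v < M.
Proof.
have [|y Py y0] := @shrink_active _ _ _ _ _ nd x0 pred0 Px0; first by [].
have [v vex vy] := extreme_below Py; exists v => //.
apply: le_lt_trans vy _; rewrite lt_neqAle sum_normal_le// andbT.
by apply/eqP => /(sum_normal_eqP Py)/(_ _ Si0); rewrite y0.
Qed.

Lemma sum_normal_neq0 : al != 0.
Proof.
have [v _] := extreme_not_common; apply: contraTneq => al0.
have := (sum_normal_eqP Px0).2 Sx0; rewrite al0 !(dotC 0) !dot0 => <-.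
by rewrite ltxx.
Qed.

(* Extreme points are determined by their active sets, so that [dot al] takes
   finitely many values on them. *)
Lemma separating_level : exists2 c, c < M &
  forall v, extreme a b v -> ~ common_side v -> dot al v < c.
Proof.
pose Q (A : {set I}) v := [/\ extreme a b v, ~ common_side v & A = [set i | active a b v i]%SET].
have /choice[g gP] : forall A, exists r, r < M /\ forall v, Q A v -> dot al v = r.
  move=> A; have [[w [wex wF wA]]|none] := pselect (exists w, Q A w); last first.
    exists (M - 1); split => [|v Qv]; first by rewrite gtrBl.
    by case: none; exists v.
  exists (dot al w); split=> [|v [[Pv vd] _ vA]].
    rewrite lt_neqAle sum_normal_le ?andbT; last exact: wex.1.
    by apply/eqP => h; apply: wF; split => //; exact: wex.1.
  have vw i : active a b v i = active a b w i.
    by move: vA; rewrite wA => /setP/(_ i); rewrite !inE.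
  rewrite -(subrK v w) [_ - v]vd ?add0r// => i vi; move: (vi); rewrite vw => wi.
  by rewrite dotB (eqP vi) (eqP wi) subrr.
pose m := \big[Num.max/M - 1]_A g A.
have mM : m < M.
  rewrite /m; elim/big_ind: _ => [|u v uM vM|A _]; first by rewrite gtrBl.
    by rewrite gt_max uM.
  by have [] := gP A.
(* The midpoint is strictly above all vertices off the face and strictly below [M]. *)
exists ((m + M) / 2); first by rewrite midf_lt.
move=> v vex vF; apply: (@le_lt_trans _ _ m); last by rewrite midf_lt.
have [_ /(_ v)->//] := gP [set i | active a b v i]%SET.
by apply: le_bigmax_cond.
Qed.

Variable c : R.
Hypothesis (cM : c < M).
Hypothesis (cv : forall v, extreme a b v -> ~ common_side v -> dot al v < c).

(* The index [None] is that of the new facet. *)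
Definition cut_normal (o : option I) : 'rV[R]_n := if o is Some i then a i else al.
Definition cut_bound (o : option I) : R := if o is Some i then b i else c.
Local Notation P' := (halfspaces cut_normal cut_bound).

Lemma cutE : P' = halfspaces a b `&` [set x | dot al x <= c].
Proof.
apply/seteqP; split => [x Px|x [Px xc] [i|]//]; last exact: Px.
by split => [i|]; [exact: (Px (Some i))|exact: (Px None)].
Qed.

Lemma cut_sub x : P' x -> halfspaces a b x.
Proof. by rewrite cutE => -[]. Qed.

Lemma cut_bounded : bounded_set P'.
Proof. by move: bP => [m [mr mP]]; exists m; split => // m' /mP PM x /cut_sub/PM. Qed.

Lemma cut_nonempty : P' !=set0.
Proof.
have [v vex vM] := extreme_not_common; exists v; rewrite cutE; split; first exact: vex.1.
by apply/ltW/cv => // -[_ /= h]; rewrite h ltxx in vM.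
Qed.

Lemma cut_side_Some i : side cut_normal cut_bound (Some i) = side a b i `&` P'.
Proof.
apply/seteqP; split => x /=; first by case=> Px xi; split => //; split => //; exact: cut_sub.
by case=> -[_ xi] Px; split.
Qed.

Lemma cut_avoids x : P' x -> ~ forall i, i \in S -> active a b x i.
Proof.
move=> Px /(sum_normal_eqP (cut_sub Px)) alM.
by have /= := Px None; rewrite alM leNgt cM.
Qed.

(** Going up from a point of the cutting hyperplane leads to a vertex at level at least [c], and
    only vertices of the removed face lie that high. *)
Lemma cut_link x : P' x -> active cut_normal cut_bound x None ->
  exists v, [/\ extreme a b v, forall i, active a b x i -> active a b v i &
                forall i, i \in S -> active a b v i].
Proof.
move=> Px /eqP /= xc; have [v [vex xv le]] := extreme_above al bP (cut_sub Px).
exists v; split => //; apply/(sum_normal_eqP vex.1).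
apply: contrapT => vM; suff : dot al v < c by rewrite ltNge -xc le.
by apply: cv => // -[].
Qed.

(** On the new facet, the direction towards the vertex of [cut_link] is killed by the old active
    normals and raises [sum_normal] by [M - c > 0], so it adjusts the new constraint alone. *)
Lemma cut_nondegenerate : nondegenerate cut_normal cut_bound.
Proof.
move=> x Px t; have [d dx] := nd (cut_sub Px) (t \o Some).
have [xc|xc] := boolP (active cut_normal cut_bound x None); last first.
  by exists d => -[i xi|]; [exact: dx|rewrite (negPf xc)].
have [v [vex xv Sv]] := cut_link Px xc.
have alM : dot al v = M by exact/(sum_normal_eqP vex.1).
exists (d + ((t None - dot al d) / (M - c)) *: (v - x)) => -[i xi|_] /=.
  have xi' : active a b x i by [].
  by rewrite dotD dotZ dotB (eqP (xv _ xi')) (eqP xi') subrr mulr0 addr0 dx.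
rewrite dotD dotZ dotB alM (eqP xc : dot al x = c) divfK ?subr_eq0 ?gt_eqF//.
by rewrite addrC subrK.
Qed.

Lemma cut_blowup : polytope_blowup (halfspaces a b) common_side P'.
Proof.
exists al, c; split; [exact: sum_normal_neq0| | |exact: cutE].
  move=> v [_ [u [d [_ vE]]]].
  have : [set v] v by [].
  by rewrite {1}vE => -[[_ /= ->] _]; exact: cM.
move=> v vP vF; apply: cv; first exact/extremeP.
(* A functional exposing [v] in the polytope also exposes it in the face. *)
move=> Fv; apply: vF; have [v0 [u [d [ud vE]]]] := vP; split => //.
exists u, d; split => [x [/ud]//|]; rewrite {1}vE.
apply/seteqP; split => [x [Px xd]|x [[Px _] xd]]; last by [].
suff -> : x = v by split => //; have : [set v] v by []; rewrite {1}vE => -[].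
by have : [set v] x by rewrite vE.
Qed.

End Cut.

(** * Frames and determinants before and after a cut *)

Lemma leq_sum_cover (X Y : finType) (h : X -> Y) (A : pred X) (B : pred Y) w :
  (forall y, B y -> exists2 x, A x & h x = y) ->
  (\sum_(y | B y) w y <= \sum_(x | A x) w (h x))%N.
Proof.
move=> cover; rewrite [leqRHS](partition_big h predT)//=.
rewrite [leqRHS](bigID B)/=; apply: leq_trans (leq_addr _ _).
apply: leq_sum => y /cover[x Ax <-].
by rewrite (bigD1 x) ?Ax ?eqxx//= leq_addr.
Qed.

Section FrameMeasure.
Context (R : realType) (n : nat) (I : finType).
Variables (a : I -> 'rV[R]_n) (b : I -> R) (lam : set 'rV[R]_n -> 'rV[int]_n).

Definition frame_index (f : {ffun 'I_n -> I}) : nat :=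
  absz (\det (frame_mx a b lam f)).

(** For a nondegenerate presentation each vertex is counted once per ordering of its facets, hence
    n! times. *)
Definition frame_measure : nat :=
  \sum_(f | `[< frame a b f >]) n.+1 ^ frame_index f.

Lemma frame_codom f x i : nondegenerate a b -> injective f -> halfspaces a b x ->
  (forall k : 'I_n, active a b x (f k)) -> active a b x i -> i \in codom f.
Proof.
move=> nd finj Px xf xi.
have sub : codom f \subset active a b x by apply/fintype.subsetP => _ /codomP[k ->]; exact: xf.
suff cc : #|codom f| = #|active a b x| by rewrite (subset_cardP cc sub).
apply/eqP; rewrite eqn_leq subset_leq_card// card_codom// card_ord.
exact: nondegenerate_card.
Qed.

End FrameMeasure.

Section CutFrames.
Context (R : realType) (n : nat) (I : finType).
Variables (a : I -> 'rV[R]_n) (b : I -> R).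
Hypotheses (bP : bounded_set (halfspaces a b)) (nd : nondegenerate a b).
Variables (S : {pred I}) (c : R).
Hypothesis (cM : c < sum_bound b S).
Hypothesis (cv : forall v, extreme a b v -> ~ common_side a b S v ->
  dot (sum_normal a S) v < c).
Local Notation a' := (cut_normal a S).
Local Notation b' := (cut_bound b c).

(** For a frame in a nondegenerate presentation: its vertex lies on the face being cut off. *)
Definition covers (f : {ffun 'I_n -> I}) : bool := [forall (i | i \in S), i \in codom f].

Definition cut_frame (f : {ffun 'I_n -> I}) (o : option 'I_n) : {ffun 'I_n -> option I} :=
  if o is Some k0 then [ffun k => if k == k0 then None else Some (f k)]
  else [ffun k => Some (f k)].

(** A vertex off the face survives; one on it is replaced by points on the edges leaving the face,
    along which a facet of [S] is dropped. *)
Definition cut_site (f : {ffun 'I_n -> I}) (o : option 'I_n) : bool :=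
  if o is Some k0 then covers f && (f k0 \in S) else ~~ covers f.

(** A frame without the new facet is an old one, and misses some facet of [S] because the cut avoids
    the face. Otherwise [cut_link] gives a vertex of the face containing the other [n - 1] facets.
    Its remaining facet [j] takes position [k0], and lies in [S], since otherwise all of [S] would
    be active at [x]. *)
Lemma cut_frameP f' : frame a' b' f' ->
  exists f o, [/\ frame a b f, f' = cut_frame f o & cut_site f o].
Proof.
move=> [finj [x Px xf]]; have [[k0 k0N]|nN] := pselect (exists k, f' k = None); last first.
  have /choice[g gP] : forall k, exists i, f' k = Some i.
    by move=> k; case E : (f' k) => [i|]; [exists i|case: nN; exists k].
  have fE : f' = [ffun k => Some ([ffun k => g k] k)] by apply/ffunP => k; rewrite !ffunE.
  exists [ffun k => g k], None; split => //.
    split; first by move=> k l; rewrite !ffunE => gkl; apply: finj; rewrite !gP gkl.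
    exists x; first exact: cut_sub Px.
    by move=> k; rewrite ffunE; have := xf k; rewrite gP.
  apply/negP => /forall_inP cov; apply: (cut_avoids cM Px) => i /cov/codomP[k ->].
  by rewrite ffunE; have := xf k; rewrite gP.
have [v [vex xv Sv]] : exists v, [/\ extreme a b v,
    forall i, active a b x i -> active a b v i &
    forall i, i \in S -> active a b v i].
  by apply: (cut_link bP cv Px); rewrite -k0N; exact: xf.
(* The value of [g] at [k0] is arbitrary; an index exists because [n > 0]. *)
have /choice[g gP] : forall k, exists i, k != k0 -> f' k = Some i.
  move=> k; case E : (f' k) => [i|]; first by exists i.
  have [i _] : exists i, active a b v i.
    apply/card_gt0P; rewrite (extreme_card nd vex); exact: leq_trans (ltn_ord k0).
  by exists i; have := finj k k0; rewrite E k0N => ->//; rewrite eqxx.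
have xg k : k != k0 -> active a b x (g k).
  by move=> kk; have := xf k; rewrite gP.
pose T := [set g k | k in predC1 k0]%SET.
have [j vj jT] : exists2 j, active a b v j & j \notin T.
  apply: contrapT => h; have : active a b v \subset T.
    by apply/fintype.subsetP => j vj; apply/negPn/negP => jT; apply: h; exists j.
  move=> /subset_leq_card; rewrite (extreme_card nd vex) leqNgt.
  move=> /negP; apply; apply: leq_ltn_trans (leq_imset_card _ _) _.
  by rewrite cardC1 card_ord prednK//; exact: leq_trans (ltn_ord k0).
pose f := [ffun k => if k == k0 then j else g k].
have jg k : k != k0 -> j <> g k.
  by move=> kk jE; move/negP: jT; apply; rewrite jE; apply: imset_f.
have ff : injective f.
  move=> k l; rewrite !ffunE; case: eqVneq => [->|kk]; case: eqVneq => [->|ll] //.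
  - by move=> /(jg _ ll).
  - by move=> /esym/(jg _ kk).
  - by move=> gkl; apply: finj; rewrite !gP// gkl.
have vf k : active a b v (f k).
  by rewrite ffunE; case: eqVneq => // kk; apply/xv/xg.
have cov : covers f.
  apply/forall_inP => i /Sv; exact: frame_codom nd ff vex.1 vf.
exists f, (Some k0); split.
- by split => //; exists v => //; exact: vex.1.
- by apply/ffunP => k; rewrite !ffunE; case: eqVneq => [->//|kk]; exact: gP.
rewrite /cut_site cov ffunE eqxx /=; apply/negPn/negP => jS.
apply: (cut_avoids cM Px) => i iS.
have /codomP[k iE] := forall_inP cov i iS; move: iS; rewrite iE ffunE.
by case: eqVneq => [_ jS'|kk _]; [rewrite jS' in jS|exact: xg].
Qed.

End CutFrames.

Section CutLabels.
Context (R : realType) (n : nat) (I : finType).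
Variables (a : I -> 'rV[R]_n) (b : I -> R) (lam : set 'rV[R]_n -> 'rV[int]_n).
Hypotheses (bP : bounded_set (halfspaces a b)) (nd : nondegenerate a b).
Hypothesis (hlam : Rcharacteristic (halfspaces a b) lam).
Variables (N : int) (w : I -> int) (u : 'rV[int]_n).
Local Notation S := [pred i | w i != 0].
Hypotheses (wN : forall i, i \in S -> 0 < w i < N) (pu : primitive u).
Hypothesis (uE : N *: u = \sum_i w i *: lam (side a b i)).
Variable c : R.
Hypothesis (cM : c < sum_bound b S).
Hypothesis (cv : forall v, extreme a b v -> ~ common_side a b S v ->
  dot (sum_normal a S) v < c).
Local Notation a' := (cut_normal a S).
Local Notation b' := (cut_bound b c).

(** Labels are functions of sets, so the index is recovered from the side, unambiguously when it is
    nonempty; 0 is a default off the sides. *)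
Definition cut_label (G : set 'rV[R]_n) : 'rV[int]_n :=
  if [pick o | `[< side a' b' o = G >]] is Some o
  then if o is Some i then lam (side a b i) else u else 0.

Lemma cut_label_side o : side a' b' o !=set0 ->
  cut_label (side a' b' o) = if o is Some i then lam (side a b i) else u.
Proof.
have nd' : nondegenerate a' b' by exact: cut_nondegenerate.
move=> [x xo]; rewrite /cut_label; case: pickP => [q /asboolP qo|/(_ o)/asboolP//].
by rewrite (side_inj nd' xo (esym qo)).
Qed.

Lemma row_cut_frame f o k : frame a' b' (cut_frame f o) ->
  row k (frame_mx a' b' cut_label (cut_frame f o)) =
  if o == Some k then u else row k (frame_mx a b lam f).
Proof.
move=> [_ [x Px xf]]; rewrite !rowK cut_label_side; last first.
  by exists x; split => //; exact/eqP/xf.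
case: o {Px xf} => [k0|]; rewrite ffunE //=.
by rewrite (inj_eq Some_inj) eq_sym; case: eqP.
Qed.

Lemma cut_frame_mx_None f : frame a' b' (cut_frame f None) ->
  frame_mx a' b' cut_label (cut_frame f None) = frame_mx a b lam f.
Proof. by move=> ff'; apply/row_matrixP => k; rewrite row_cut_frame. Qed.

(** As the frame contains all of [S], the new label times [N] is a combination of the rows of the
    frame, with coefficient [w (f k0)] on the row it replaces. *)
Lemma det_cut_frame f k0 : covers S f -> frame a b f ->
  frame a' b' (cut_frame f (Some k0)) ->
  N * \det (frame_mx a' b' cut_label (cut_frame f (Some k0))) =
  w (f k0) * \det (frame_mx a b lam f).
Proof.
move=> cov ff ff'.
rewrite (@det_replace_row _ _ (frame_mx a b lam f) _ k0 N (\row_k w (f k))) ?mxE//.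
  by move=> k kk0; rewrite row_cut_frame// (inj_eq Some_inj) eq_sym (negPf kk0).
rewrite row_cut_frame// eqxx uE mulmx_sum_row (sum_frame ff) => [|i ni].
  by apply: eq_bigr => k _; rewrite mxE rowK.
have [iS|] := boolP (i \in S); first by rewrite (forall_inP cov i iS) in ni.
by rewrite inE negbK => /eqP ->; rewrite scale0r.
Qed.

Lemma cut_label_Rcharacteristic : halfspaces a' b' !=set0 ->
  Rcharacteristic (halfspaces a' b') cut_label.
Proof.
move=> P0'; apply: Rcharacteristic_frames => // [||[i|] s0|f' ff'].
- exact: cut_bounded.
- exact: cut_nondegenerate.
- rewrite cut_label_side//; case: s0 => x; rewrite cut_side_Some => -[xi _].
  by case: hlam => + _; apply; exact: (facet_side nd xi).
- by rewrite cut_label_side.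
have [f [q [ff fo]]] := cut_frameP bP nd cM cv ff'; rewrite {}fo in ff' *.
have D0 := frame_det_neq0 nd hlam ff.
case: q ff' => [k0|] ff'; last by rewrite cut_frame_mx_None.
move=> /andP[cov fS]; apply/eqP => d0.
have := det_cut_frame cov ff ff'; rewrite d0 mulr0 => /esym/eqP.
by rewrite mulf_eq0 (negPf D0) orbF gt_eqF//; case/andP: (wN fS).
Qed.

Lemma cut_frame_index_lt f k0 : covers S f -> f k0 \in S -> frame a b f ->
  frame a' b' (cut_frame f (Some k0)) ->
  (frame_index a' b' cut_label (cut_frame f (Some k0)) < frame_index a b lam f)%N.
Proof.
move=> cov fS ff ff'; have /(congr1 absz) := det_cut_frame cov ff ff'.
rewrite !abszM -!/(frame_index _ _ _ _).
have : (0 < frame_index a b lam f)%N by rewrite absz_gt0 (frame_det_neq0 nd hlam ff).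
have /andP[] := wN fS; set d := frame_index _ _ _ _; set d' := frame_index _ _ _ _.
move: (w (f k0)) => s s0 sN d0 E; rewrite ltnNge; apply/negP => le.
have : (absz s < absz N)%N by lia.
nia.
Qed.

(** The new frames are charged to the old ones they come from. No old frame is charged more than its
    weight, and a covering one strictly less, which the summand [covers S f] records; [f0] makes the
    total strict. *)
Lemma frame_measure_cut_lt f0 : frame a b f0 -> covers S f0 ->
  (frame_measure a' b' cut_label < frame_measure a b lam)%N.
Proof.
move=> ff0 cov0.
pose good f o := `[< frame a' b' (cut_frame f o) >] && cut_site S f o.
pose D f := (n.+1 ^ frame_index a b lam f)%N.
pose D' f' := (n.+1 ^ frame_index a' b' cut_label f')%N.
apply: (@leq_ltn_trans (\sum_(f | `[< frame a b f >])
    \sum_(o | good f o) D' (cut_frame f o))).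
  rewrite pair_big_dep /=.
  apply: (@leq_sum_cover _ _ (fun p => cut_frame p.1 p.2)) => f' /asboolP ff'.
  have [f [q [ff fo h]]] := cut_frameP bP nd cM cv ff'; exists (f, q) => //=.
  by rewrite /good -fo h andbT; apply/andP; split; exact/asboolP.
(* A covering frame of index [d] gives at most [n] frames of index at most
   [d - 1], and [n * n.+1 ^ (d - 1) < n.+1 ^ d]. *)
have le f : frame a b f -> (\sum_(o | good f o) D' (cut_frame f o) + covers S f <= D f)%N.
  move=> ff; have [cov|ncov] := boolP (covers S f); last first.
    have [gN|gN] := boolP (good f None); last first.
      rewrite big_pred0// => -[k|]; last exact: negbTE.
      by rewrite /good /= (negPf ncov) andbF.
    rewrite (big_pred1 None) => [|[k|]//]; last by rewrite /good /= (negPf ncov) andbF.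
    case/andP: gN => /asboolP ff' _; rewrite addn0.
    by rewrite /D' /frame_index cut_frame_mx_None.
  have d0 : (0 < frame_index a b lam f)%N.
    by rewrite absz_gt0 (frame_det_neq0 nd hlam ff).
  rewrite addn1 /D -(prednK d0) expnS mulSn -add1n leq_add ?expn_gt0//.
  apply: (@leq_trans (\sum_(o | good f o) n.+1 ^ (frame_index a b lam f).-1)).
    apply: leq_sum => -[k|] /andP[/asboolP ff' /=]; last by rewrite cov.
    move=> /andP[_ fS]; apply: leq_pexp2l => //; rewrite -ltnS prednK//.
    exact: cut_frame_index_lt.
  rewrite sum_nat_const leq_mul2r; apply/orP; right.
  apply: (@leq_trans #|predC1 (None : option 'I_n)|); last first.
    by rewrite cardC1 card_option card_ord.
  apply: subset_leq_card; apply/fintype.subsetP => -[k|] //.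
  by rewrite unfold_in /good /= cov andbF.
rewrite /frame_measure (bigD1 f0) ?asboolE//= [ltnRHS](bigD1 f0) ?asboolE//=.
rewrite -addSn leq_add//; first by have := le _ ff0; rewrite cov0 addn1.
apply: leq_sum => f /andP[/asboolP ff _].
exact: leq_trans (leq_addr _ _) (le _ ff).
Qed.

End CutLabels.

(** * Descent to a toric manifold *)

Lemma exists_smaller_blowup (R : realType) n (X : Rcharacteristic_pair R n)
    (I : finType) (a : I -> 'rV[R]_n) b :
  rpoly X = halfspaces a b -> nondegenerate a b -> ~ toric_manifold X ->
  exists (J : finType) (a' : J -> 'rV[R]_n) b' (Y : Rcharacteristic_pair R n),
    [/\ rpoly Y = halfspaces a' b', nondegenerate a' b',
        (frame_measure a' b' (rlam Y) < frame_measure a b (rlam X))%N &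
        exists S : set (toric_orbifold X), toric_blowup Y X S].
Proof.
case: X => P lam hP hlam PE; have {}PE : P = halfspaces a b := PE.
subst P => nd nman.
have [[bP _] [x [B [Px _ _ _]]] _] := hP.
have P0 : halfspaces a b !=set0 by exists x.
have [f ff D1] : exists2 f, frame a b f & `|\det (frame_mx a b lam f)| != 1.
  apply: contrapT => h; apply: nman; apply: (characteristic_frames bP nd P0 hlam).
  by move=> f ff; apply/eqP/negPn/negP => fd; apply: h; exists f.
have [N [r [u [rN r0 pu uE]]]] :=
  fractional_combination (frame_det_neq0 nd hlam ff) D1.
have [finj [x0 Px0 xf]] := ff.
(* The coefficients move from positions in the frame to facets; injectivity of [f] leaves at most
   one term, and facets off the frame get 0. *)
pose w i : int := \sum_(k | f k == i) r 0 k.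
have wf k : w (f k) = r 0 k.
  by rewrite /w (big_pred1 k)// => l; rewrite /= (inj_eq finj).
have wC i : i \notin codom f -> w i = 0.
  move=> iN; rewrite /w big_pred0// => k; apply/negbTE.
  by apply: contra iN => /eqP <-; exact: codom_f.
pose S := [pred i | w i != 0].
have Sf i : i \in S -> i \in codom f by apply: contraLR => /wC wi; rewrite inE wi eqxx.
have wN i : i \in S -> 0 < w i < N.
  move=> iS; have /codomP[k ik] := Sf _ iS; move: iS; rewrite ik inE wf => rk.
  by have /andP[rk0 ->] := rN k; rewrite lt_neqAle eq_sym rk rk0.
have {}uE : N *: u = \sum_i w i *: lam (side a b i).
  rewrite uE mulmx_sum_row (sum_frame ff) => [|i /wC ->]; last by rewrite scale0r.
  by apply: eq_bigr => k _; rewrite wf rowK.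
have [k Sk] : exists k, f k \in S.
  apply/existsP; apply: contraNT r0 => /existsPn h; apply/eqP/rowP => k.
  by have := h k; rewrite inE wf negbK mxE => /eqP.
have Sx0 i : i \in S -> active a b x0 i by move=> /Sf/codomP[l ->]; exact: xf.
have [c cM cv] := separating_level a b S.
have P0' := cut_nonempty bP nd Sk Px0 cv.
have nd' := cut_nondegenerate bP nd cM cv.
have hP' := simple_halfspaces (cut_bounded bP S c) P0' nd'.
have hlam' := cut_label_Rcharacteristic bP nd hlam wN pu uE cM cv P0'.
exists _, (cut_normal a S), (cut_bound b c), (RCharacteristicPair hP' hlam').
split => //.
  apply: (frame_measure_cut_lt bP nd hlam wN uE cM cv ff).
  by apply/forall_inP => i /Sf.
exists [set m : toric_orbifold (RCharacteristicPair hP hlam) |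
  common_side a b S (\val (orbit_map m))].
exists (common_side a b S).
split => //=; first exact: face_common_side Px0 Sx0.
  exact: (cut_blowup bP nd Sk Px0 Sx0 cM cv).
move=> G /(facetE nd)[i _ ->]; rewrite -(cut_side_Some a b S c i) => -[[s0 _] _].
exact: (cut_label_side lam bP nd u cM cv s0).
Qed.

(** Induction on the frame measure, for all index types at once, since each cut adds an index. *)
Lemma resolution (R : realType) n (X : Rcharacteristic_pair R n) (I : finType)
    (a : I -> 'rV[R]_n) b : rpoly X = halfspaces a b -> nondegenerate a b ->
  exists (d : nat) (Y : nat -> Rcharacteristic_pair R n),
    [/\ Y 0%N = X, toric_manifold (Y d) &
        forall i, (i < d)%N ->
          exists S : set (toric_orbifold (Y i)), toric_blowup (Y i.+1) (Y i) S].
Proof.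
have [m] := ubnP (frame_measure a b (rlam X)).
elim: m => // m IH in X I a b * => lem PE nd.
have [Xman|Xman] := pselect (toric_manifold X); first by exists 0%N, (fun=> X).
have [J [a' [b' [Y [YE nd' lt blow]]]]] := exists_smaller_blowup PE nd Xman.
have [d [Z [Z0 Zd Zblow]]] := IH _ _ _ _ (leq_trans lt lem) YE nd'.
exists d.+1, (fun i => if i is j.+1 then Z j else X); split => // -[_|i /Zblow//].
by rewrite Z0.
Qed.

Theorem theoremA (R : realType) (n : nat)
    (P : set 'rV[R]_n) (hP : simple_polytope P)
    (lam : set 'rV[R]_n -> 'rV[int]_n) (hlam : Rcharacteristic P lam) :
  exists (d : nat) (X : nat -> Rcharacteristic_pair R n),
    [/\ X 0%N = RCharacteristicPair hP hlam,
        toric_manifold (X d) &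
        forall i : nat, (i < d)%N ->
          exists S : set (toric_orbifold (X i)), toric_blowup (X i.+1) (X i) S].
Proof.
have [m [a [b [PE nd]]]] := simple_polytope_presentation hP.
exact: (@resolution _ _ (RCharacteristicPair hP hlam) _ a b).
Qed.
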